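(* Fix integers $d\geq 2$ and $1\leq\ell\leq d-1$. Then for any $\rho>0$ the intersection $\mathcal W_{d,\rho}\cap\mathbb R^\ell$ of the $d$-dimensional Poisson-Voronoi tessellation $\mathcal W_{d,\rho}$ of intensity $\rho$ with $\mathbb R^\ell$ has the same distribution as the $\beta$-Voronoi tessellation $\mathcal V_{\ell,\beta,\gamma}$ in $\mathbb R^\ell$ with parameters $$\beta=\frac{d-\ell}{2}-1,\qquad \gamma=\frac{\pi^{\frac{d+1}{2}}\rho}{\Gamma\left(\frac{d+1}{2}\right)}.$$
   Context: A tessellation in $\mathbb R^n$ is a countable, locally finite collection of $n$-dimensional convex polytopes (cells) with disjoint interiors covering $\mathbb R^n$. A random tessellation is a particle process (a point process on the space of non-empty compact subsets of $\mathbb R^n$) whose support is almost surely a face-to-face tessellation; distributions are understood in this sense. $\mathcal W_{d,\rho}$ is the collection of Voronoi cells $\{z\in\mathbb R^d:\|x-z\|\le\|y-z\|\ \forall y\in\zeta\setminus\{x\}\}$, $x\in\zeta$, of a homogeneous Poisson point process $\zeta$ on $\mathbb R^d$ with intensity $\rho$. For a countable set $X\subset\mathbb R^\ell\times\mathbb R$ the Laguerre cell of $(v,h)\in X$ is $\{w\in\mathbb R^\ell:\|w-v\|^2+h\leq\|w-v'\|^2+h'\text{ for all }(v',h')\in X\}$ and $\mathcal L(X)$ is the collection of all non-empty Laguerre cells. For $\beta>-1$, $\gamma>0$, $\mathcal V_{\ell,\beta,\gamma}=\mathcal L(\eta_{\ell,\beta,\gamma})$ where $\eta_{\ell,\beta,\gamma}$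 is a Poisson point process on $\mathbb R^\ell\times[0,\infty)$ whose intensity measure has Lebesgue density $(v,h)\mapsto\gamma\,\frac{\Gamma(\frac{\ell+1}{2}+\beta+1)}{\pi^{(\ell+1)/2}\Gamma(\beta+1)}\,h^\beta$. $\mathbb R^\ell$ is identified with the linear subspace of $\mathbb R^d$ spanned by the first $\ell$ standard basis vectors, and $\mathcal W_{d,\rho}\cap\mathbb R^\ell$ denotes the random tessellation of $\mathbb R^\ell$ whose cells are the non-empty sets $c\cap\mathbb R^\ell$, $c\in\mathcal W_{d,\rho}$. *)

(* Defs.v *)
From HB Require Import structures.
From mathcomp Require Import all_boot all_order all_algebra.
From mathcomp Require Import all_classical all_reals all_analysis
  measurable_realfun.

Set Implicit Arguments.
Unset Strict Implicit.
Unset Printing Implicit Defensive.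

Import Order.TTheory GRing.Theory Num.Theory.
Import numFieldTopology.Exports numFieldNormedType.Exports.

Local Open Scope classical_set_scope.
Local Open Scope ring_scope.

Section analysis.
Context {R : realType}.

(* The norm that the library puts on ['rV[R]_n] is the sup norm. *)
Definition enorm n (x : 'rV[R]_n) : R := Num.sqrt (\sum_(i < n) x 0 i ^+ 2).

Definition Gamma (s : R) : R :=
  (\int[lebesgue_measure]_(t in `]0, +oo[) (t `^ (s - 1) * expR (- t)))%R.

(* Integral of a nonnegative Borel function with respect to n-dimensional
   Lebesgue measure, written as an iterated integral (Tonelli). *)
Fixpoint lebesgue_int n : ('rV[R]_n -> \bar R) -> \bar R :=
  match n with
  | 0 => fun f => f (0 : 'rV[R]_0)%R
  | m.+1 => fun f =>
      \int[lebesgue_measure]_(x in [set: R])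
        lebesgue_int (fun v : 'rV[R]_m =>
          f (row_mx (const_mx x : 'rV[R]_1) v))
  end%E.

End analysis.

Definition borel (T : topologicalType) : set_system T := <<s @open T >>.

Definition npoints {R : realType} {T : choiceType} (X B : set T) : \bar R :=
  counting (X `&` B).

Section poisson.
Context {R : realType} {d : measure_display} {Omega : measurableType d}.
Context {T : topologicalType}.

(* Poisson point process on [T] with intensity measure [Lambda]. The process is
   given by its random locally finite set of points, which up to a null set is
   no restriction when [Lambda] is diffuse. Only the values of [Lambda] on Borel
   sets matter. The library's [poisson_pmf] is not used for the marginals because
   it is not the Poisson law when the parameter is 0. *)
Definition poisson_process (P : probability Omega R) (Lambda : set T -> \bar R)
    (X : Omega -> set T) : Prop :=
  let N (B : set T) (w : Omega) : \bar R := npoints (X w) B in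
  [/\ forall w K, compact K -> finite_set (X w `&` K),
      forall B, borel B -> measurable_fun [set: Omega] (N B),
      forall B, borel B ->
        match Lambda B with
        | r%:E => forall k : nat,
            P [set w | N B w = k%:R%:E] = (expR (- r) * r ^+ k / k`!%:R)%:E
        | _ => P [set w | N B w = +oo%E] = 1%E
        end
    & forall n (B : 'I_n -> set T) (A : 'I_n -> set (\bar R)),
        (forall i, borel (B i)) -> trivIset [set: 'I_n] B ->
        (forall i, measurable (A i)) ->
        P (\bigcap_(i in [set: 'I_n]) (N (B i) @^-1` A i)) =
        \big[*%E/1%E]_(i < n) P (N (B i) @^-1` A i)].

End poisson.

Section tessellations.
Context {R : realType}.

Definition voronoi_cell d (X : set 'rV[R]_d) (x : 'rV[R]_d) : set 'rV[R]_d :=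
  [set z | forall y, (X `\ x) y -> enorm (x - z) <= enorm (y - z)].

Definition voronoi d (X : set 'rV[R]_d) : set (set 'rV[R]_d) :=
  [set voronoi_cell X x | x in X].

Definition laguerre_cell l (X : set ('rV[R]_l * R)) (p : 'rV[R]_l * R) :
    set 'rV[R]_l :=
  [set w | forall q, X q ->
     enorm (w - p.1) ^+ 2 + p.2 <= enorm (w - q.1) ^+ 2 + q.2].

Definition laguerre l (X : set ('rV[R]_l * R)) : set (set 'rV[R]_l) :=
  [set laguerre_cell X p | p in X] `\ set0.

(* Inclusion of the span of the first [l] basis vectors, for [l <= d]. *)
Definition embed l d (w : 'rV[R]_l) : 'rV[R]_d :=
  \row_(j < d) oapp (fun i : 'I_l => w 0 i) 0 (insub (val j)).

(* The cells cut out on R^l, seen as subsets of R^l itself. *)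
Definition tess_section l d (W : set (set 'rV[R]_d)) : set (set 'rV[R]_l) :=
  [set embed d @^-1` c | c in W] `\ set0.

End tessellations.

Arguments tess_section {R} l {d} W.

Section particle_processes.
Context {R : realType} (n : nat).

Definition nonempty_compacts : set (set 'rV[R]_n) :=
  [set C | C !=set0 /\ compact C].

Definition thicken (C : set 'rV[R]_n) (e : R) : set 'rV[R]_n :=
  [set y | exists2 x, C x & enorm (y - x) <= e].

Definition hausdorff_open (U : set (set 'rV[R]_n)) : Prop :=
  U `<=` nonempty_compacts /\
  forall C, U C -> exists2 e : R, 0 < e & forall D, nonempty_compacts D ->
    C `<=` thicken D e -> D `<=` thicken C e -> U D.

Definition hausdorff_borel : set (set (set 'rV[R]_n)) :=
  <<s nonempty_compacts, hausdorff_open >>.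

Definition count_events : set (set (set (set 'rV[R]_n))) :=
  [set E | exists B (A : set (\bar R)), [/\ hausdorff_borel B, measurable A &
    E = [set X | A (npoints X B)]]].

(* Configurations of particles. Every collection of sets is allowed, but the
   sigma-algebra only sees its members that are nonempty and compact. *)
Definition particle_config := g_sigma_algebraType count_events.

End particle_processes.

Arguments particle_config R n : clear implicits.

Section laws.
Context {R : realType}.

(* Equality of the distributions of two particle processes, together with the
   measurability that gives these distributions a meaning. *)
Definition same_distribution n
    {d1 : measure_display} {O1 : measurableType d1} (P1 : probability O1 R)
    (X1 : O1 -> particle_config R n)
    {d2 : measure_display} {O2 : measurableType d2} (P2 : probability O2 R)
    (X2 : O2 -> particle_config R n) : Prop :=
  [/\ measurable_fun [set: O1] X1, measurable_fun [set: O2] X2 &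
      forall E : set (particle_config R n), measurable E ->
        pushforward P1 X1 E = pushforward P2 X2 E].

Definition homogeneous_poisson {d0 : measure_display} {O : measurableType d0}
    (P : probability O R) d (rho : R) (zeta : O -> set 'rV[R]_d) : Prop :=
  poisson_process P
    (fun B => rho%:E * lebesgue_int (fun x => (\1_B x)%:E))%E zeta.

Definition beta_density l (beta gamma : R) (h : R) : R :=
  gamma * (Gamma (l.+1%:R / 2 + beta + 1)
           / (pi `^ (l.+1%:R / 2) * Gamma (beta + 1))) * h `^ beta.

Definition beta_poisson {d0 : measure_display} {O : measurableType d0}
    (P : probability O R) l (beta gamma : R)
    (eta : O -> set ('rV[R]_l * R)) : Prop :=
  (forall w p, eta w p -> 0 <= p.2) /\
  poisson_process P
    (fun B => lebesgue_int (fun v : 'rV[R]_l =>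
       \int[lebesgue_measure]_(h in `[0%R, +oo[)
          (beta_density l beta gamma h * \1_B (v, h))%:E))%E eta.

End laws.

(* Main.v *)
Require Import Defs.
From HB Require Import structures.
From mathcomp Require Import all_boot all_order all_algebra finmap.
From mathcomp Require Import all_classical all_reals all_analysis measurable_realfun.
From mathcomp Require Import ring lra.

(** Write d = l + m and send a point x of R^d to [radial_map x], the pair of
    its first l coordinates and the squared norm of its last m coordinates.
    For w in R^l, Pythagoras gives |x - w|^2 = |x' - w|^2 + h with
    (x', h) = [radial_map x]: the distances that decide the Voronoi cells at the
    points of R^l are the powers that decide Laguerre cells. Hence the section
    of the Voronoi tessellation of any set Z is the Laguerre tessellation of
    its image under [radial_map] ([tess_section_voronoi]), and nothing random
    is involved in this step.

    It remains to compare the image of the homogeneous Poisson process with the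
    process that defines the beta-Voronoi tessellation. Images of Poisson
    processes are Poisson, so it is enough to compare intensity measures. They
    are products over R^l, and the claim is that Lebesgue measure on R^m is
    carried by the squared norm to the measure with density
    pi^(m/2) / Gamma(m/2) h^(m/2 - 1) ([radial_law]). The power of h comes from
    the behaviour of volumes under dilations, and the constant from integrating
    exp(-|y|^2) in two ways; no volume of a ball has to be computed. The
    Gamma factors then cancel ([beta_densityE]) and the intensities agree
    ([intensity_radial_map]).

    Equality of the laws of the tessellations needs that a tessellation is a
    measurable function of its process. Both processes are recorded as random
    locally finite measures. Their counts on disjoint sets are independent and
    have the same marginals, so the two random measures have the same law
    ([lf_law_unique]). Two points of R^d may share their image, and the image
    of the counting measure remembers multiplicities; this does no harm, because
    a Laguerre tessellation depends only on which Borel sets contain a point.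
    Measurability of the tessellation is therefore expressed as: every event
    about it is decided by a measurable set of measures, which gives the right
    answer for every measure that sees the point set ([tracked], [represents],
    [tracked_particle_config]).

    The measurability rests on two countable descriptions. A Laguerre cell meets
    a closed ball iff for every n some rational point of a slightly larger ball
    satisfies the inequalities of the cell up to an error 1/(n+1)
    ([cell_meets_closed_ballP]); the sets that a compact cell meets generate the
    Borel sets of the Hausdorff distance. And counting is done on cells, not on
    points, since two points can have the same cell: k cells are distinct iff
    finitely many rational balls tell them apart ([code_separates],
    [tracked_count_ge]). *)

Set Implicit Arguments.
Unset Strict Implicit.
Unset Printing Implicit Defensive.

Import Order.TTheory GRing.Theory Num.Theory.
Import numFieldTopology.Exports numFieldNormedType.Exports.

Local Open Scope classical_set_scope.
Local Open Scope ring_scope.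

(** * The iterated Lebesgue integral *)
Section lebesgue_int_theory.
Context {R : realType}.
Local Open Scope ereal_scope.

Lemma eq_lebesgue_int n (f g : 'rV[R]_n -> \bar R) :
  f =1 g -> lebesgue_int f = lebesgue_int g.
Proof. by move=> /funext ->. Qed.

Lemma lebesgue_int_ge0 n (f : 'rV[R]_n -> \bar R) :
  (forall x, 0 <= f x) -> 0 <= lebesgue_int f.
Proof.
by elim: n f => [|n IHn] f f0 //=; apply: integral_ge0 => x _; exact: IHn.
Qed.

Lemma lebesgue_int_split l m (f : 'rV[R]_(l + m) -> \bar R) :
  lebesgue_int f =
  lebesgue_int (fun v : 'rV[R]_l => lebesgue_int (fun y : 'rV[R]_m =>
    f (row_mx v y))).
Proof.
elim: l f => [|l IHl] f /=.
  apply: eq_lebesgue_int => y; congr f.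
  by apply/rowP => j; rewrite mxE; case: splitP => [[]//|k jk]; congr (y _ _); exact/val_inj.
apply: eq_integral => x _; rewrite IHl; apply: eq_lebesgue_int => v.
apply: eq_lebesgue_int => y; congr f; apply/rowP => j.
rewrite !mxE; case: (@splitP 1 (l + m) j) => [i ji|k jk].
  case: (splitP j) => [i' ji'|k' jk']; last by move: jk'; rewrite ji ord1.
  rewrite !mxE; case: splitP => [i''|k'' jk'']; first by rewrite !mxE.
  by move: ji'; rewrite ji ord1 jk''.
rewrite !mxE; case: (splitP k) => [i ki|k' kk'].
  case: (splitP j) => [i' ji'|k' jk']; last first.
    have := ltn_ord i; rewrite -ki; move: jk'; rewrite jk add1n addSn => -[->].
    by rewrite ltnNge leq_addr.
  rewrite !mxE; case: splitP => [i''|k'' jk''].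
    by move=> H; move: ji'; rewrite jk H ord1.
  by congr (v _ _); apply/val_inj/eqP; rewrite /= -ki -(eqn_add2l 1) -jk -jk'' ji'.
case: (splitP j) => [i' ji'|k'' jk''].
  have := ltn_ord i'; rewrite -ji' jk kk' add1n ltnS ltnNge.
  by rewrite leq_addr.
congr (y _ _); apply/val_inj/eqP; rewrite /=.
by rewrite -(eqn_add2l (1 + l)) -jk'' jk kk' addnA.
Qed.

(** Positive scalars come out of the integral of any nonnegative function,
    measurable or not: the integral is a supremum over simple functions below
    it, and scaling permutes these. An iterated integral needs this form, as
    nothing ensures that its inner integrals depend measurably on the outer
    variable. *)
Lemma ge0_integralZl_total d (T : measurableType d)
    (mu : {measure set T -> \bar R}) (f : T -> \bar R) (k : R) :
  (0 < k)%R -> (forall x, 0 <= f x) ->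
  \int[mu]_x (k%:E * f x) = k%:E * \int[mu]_x f x.
Proof.
have le_int (c : R) (g : T -> \bar R) : (0 < c)%R -> (forall x, 0 <= g x) ->
    c%:E * \int[mu]_x g x <= \int[mu]_x (c%:E * g x).
  move=> c0 g0.
  have cg0 x : 0 <= c%:E * g x by rewrite mule_ge0// lee_fin ltW.
  rewrite muleC -lee_pdivlMr// !ge0_integralTE//; apply: ge_ereal_sup.
  move=> _ [h /= hg <-]; rewrite lee_pdivlMr// muleC -sintegralrM//.
  apply: ereal_sup_ubound; exists (scale_nnsfun h (ltW c0)) => //= x.
  by rewrite EFinM lee_pmul2l// hg.
move=> k0 f0; apply/eqP; rewrite eq_le le_int// andbT.
have kf0 x : 0 <= k%:E * f x by rewrite mule_ge0// lee_fin ltW.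
have := le_int k^-1%R _ _ kf0; rewrite invr_gt0 => /(_ k0).
under [X in _ <= X]eq_integral do rewrite muleA -EFinM mulVf ?gt_eqF// mul1e.
move=> H; rewrite -(@lee_pmul2l _ k^-1%:E)// ?lte_fin ?invr_gt0//.
by rewrite muleA -EFinM mulVf ?gt_eqF// mul1e.
Qed.

Lemma lebesgue_intZl n (f : 'rV[R]_n -> \bar R) (k : R) :
  (0 < k)%R -> (forall x, 0 <= f x) ->
  lebesgue_int (fun x => k%:E * f x) = k%:E * lebesgue_int f.
Proof.
move=> k0; elim: n f => [|n IHn] f f0 //=.
rewrite -ge0_integralZl_total//.
  by apply: eq_integral => x _; rewrite IHn.
by move=> x; exact: lebesgue_int_ge0.
Qed.

End lebesgue_int_theory.

(** * The law of the squared norm under Lebesgue measure *)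
Section sqnorm.
Context {R : realType}.

Definition sqnorm n (x : 'rV[R]_n) : R := \sum_(i < n) x 0 i ^+ 2.

Lemma sqnorm_ge0 n (x : 'rV[R]_n) : 0 <= sqnorm x.
Proof. by apply: sumr_ge0 => i _; exact: sqr_ge0. Qed.

Lemma sqnorm_row_mx m n (x : 'rV[R]_m) (y : 'rV[R]_n) :
  sqnorm (row_mx x y) = sqnorm x + sqnorm y.
Proof.
by rewrite /sqnorm big_split_ord/=; congr (_ + _); apply: eq_bigr => i _;
  rewrite (row_mxEl, row_mxEr).
Qed.

End sqnorm.

Section image_measure.
Context d d' (T1 : measurableType d) (T2 : measurableType d') (R : realType).

(** The proof of measurability is an argument, so that a pushforward can be
    named as a measure where no canonical measurable function is at hand. *)
Definition image_measure (m : {measure set T1 -> \bar R}) (f : T1 -> T2)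
    (mf : measurable_fun [set: T1] f) : {measure set T2 -> \bar R}.
Proof. by refine (pushforward m f : {measure set T2 -> \bar R}). Defined.

End image_measure.

Section with_sigma_finite.
Context d (T : measurableType d) (R : realType).
Context (mu : {measure set T -> \bar R}) (mu_sfin : sigma_finite setT mu).

(** Carries a proof of sigma-finiteness in the term, for the benefit of
    instance inference. *)
Definition with_sigma_finite of sigma_finite setT mu : set T -> \bar R := mu.

HB.instance Definition _ := Measure.on (with_sigma_finite mu_sfin).

HB.instance Definition _ := @isSFinite.Build _ _ _
  (with_sigma_finite mu_sfin) (sfinite_measure_sigma_finite mu_sfin).

HB.instance Definition _ := @isSigmaFinite.Build _ _ _
  (with_sigma_finite mu_sfin) mu_sfin.

End with_sigma_finite.

Section radial.
Context {R : realType}.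
Local Open Scope ereal_scope.
Local Notation leb := (@lebesgue_measure R).

Lemma lebesgue_measure_scale (c : R) : (0 < c)%R ->
  forall A : set (measurableTypeR R), measurable A ->
  leb A = c%:E * leb ((fun x => c * x)%R @^-1` A).
Proof.
move=> c0 A mA.
have mc : measurable_fun [set: measurableTypeR R] (fun x : R => (c * x)%R : measurableTypeR R).
  by apply: measurable_funM => //.
pose mu : {measure set (measurableTypeR R) -> \bar R} :=
  mscale (NngNum (ltW c0)) (image_measure leb mc).
have -> : leb A = mu A; last by [].
apply: lebesgue_measure_unique => // _ [[a b] _ <-].
have <- : c%:E * leb `](a / c)%R, (b / c)%R]%classic = mu `]a, b]%classic.
  congr (_ * leb _); apply/seteqP; split => x /=.
    by rewrite !in_itv/= ltr_pdivrMr// ler_pdivlMr// mulrC.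
  by rewrite !in_itv/= ltr_pdivrMr// ler_pdivlMr// (mulrC x).
rewrite !lebesgue_measure_itv/= !lte_fin ltr_pM2r ?invr_gt0//.
case: ifPn => _; last by rewrite mule0.
by rewrite -EFinD -EFinM -mulrBl mulrC divfK ?gt_eqF.
Qed.

Lemma integral_lebesgue_scale (c : R) (f : R -> \bar R) : (0 < c)%R ->
  measurable_fun [set: R] f -> (forall x, 0 <= f x) ->
  \int[leb]_x f x = c%:E * \int[leb]_x f (c * x)%R.
Proof.
move=> c0 mf f0.
have mc : measurable_fun [set: measurableTypeR R] (fun x : R => (c * x)%R : measurableTypeR R).
  by apply: measurable_funM => //.
rewrite (eq_measure_integral (mscale (NngNum (ltW c0)) (image_measure leb mc))); last first.
  by move=> A mA _; exact: lebesgue_measure_scale.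
rewrite ge0_integral_mscale//= ge0_integral_pushforward//.
Qed.

(** The image of Lebesgue measure on R^m under the squared norm exists as a
    sigma-finite measure [nu]: by induction on m, it is the image of
    Lebesgue measure on R times the previous measure under (x, y) |-> x^2 + y.
    The last property, that dilating by c multiplies volumes by c^m, is what
    determines the distribution function of [nu] up to a constant. *)
Lemma radial_measure m :
  exists nu : {sigma_finite_measure set (measurableTypeR R) -> \bar R}, [/\
    forall g : R -> \bar R, measurable_fun [set: R] g -> (forall x, 0 <= g x) ->
      lebesgue_int (fun y : 'rV[R]_m => g (sqnorm y)) = \int[nu]_x g x,
    forall r, (r < 0)%R -> nu `]-oo, r]%classic = 0,
    forall r, nu `]-oo, r]%classic < +oo &
    forall c r, (0 < c)%R ->
      nu `]-oo, (c ^+ 2 * r)%R]%classic = (c ^+ m)%:E * nu `]-oo, r]%classic].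
Proof.
elim: m => [|m [nu [nuE nu_neg nufin nuZ]]].
  exists (\d_(0%R : measurableTypeR R) :
    {sigma_finite_measure set (measurableTypeR R) -> \bar R}); split.
  - move=> g mg g0; rewrite integral_dirac// diracT mul1e /=.
    by rewrite /sqnorm big_ord0.
  - by move=> r r0; rewrite /= diracE memNset//= in_itv/= leNgt r0.
  - by move=> r; rewrite /= diracE ltry.
  - move=> c r c0; rewrite expr0 mul1e /= !diracE; congr (_%:R%:E); congr nat_of_bool.
    by apply/idP/idP; rewrite !inE/= !in_itv/= pmulr_rge0 ?exprn_gt0.
pose T := measurableTypeR R.
pose s (z : T * T) : T := (z.1 ^+ 2 + z.2)%R.
have ms : measurable_fun [set: T * T] s.
  apply: measurable_funD; last exact: measurable_snd.
  exact: measurable_funX measurable_fst.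
pose mu : {measure set T -> \bar R} := image_measure (leb \x nu) ms.
have muE (g : R -> \bar R) : measurable_fun [set: R] g -> (forall x, 0 <= g x) ->
    \int[mu]_x g x = \int[leb]_x \int[nu]_y g (x ^+ 2 + y)%R.
  move=> mg g0; rewrite ge0_integral_pushforward// fubini_tonelli1//.
    exact: measurableT_comp.
  by move=> z; exact: g0.
have mu_cdf r : mu `]-oo, r]%classic = \int[leb]_x nu `]-oo, (r - x ^+ 2)%R]%classic.
  transitivity (\int[mu]_x (\1_(`]-oo, r]%classic : set R) x)%:E).
    by rewrite integral_indic// setIT.
  rewrite (muE (fun x => (\1_(`]-oo, r]%classic : set R) x)%:E)); last 2 first.
    by apply/measurable_EFinP; exact: measurable_indic.
    by move=> x; rewrite lee_fin.
  apply: eq_integral => x _.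
  transitivity (\int[nu]_y (\1_(`]-oo, (r - x ^+ 2)%R]%classic : set R) y)%:E).
    apply: eq_integral => y _; congr (_%:E); rewrite !indicE; congr (_%:R).
    by congr nat_of_bool; apply/idP/idP; rewrite !inE/= !in_itv/= lerBrDl.
  by rewrite integral_indic// setIT.
have nu_mono r r' : (r <= r')%R -> nu `]-oo, r]%classic <= nu `]-oo, r']%classic.
  by move=> rr'; apply: le_measure; rewrite ?inE//; apply: subset_itvl; rewrite bnd_simp.
have mnu : measurable_fun [set: R] (fun r => nu `]-oo, r]%classic).
  have nufnum r : nu `]-oo, r]%classic \is a fin_num by rewrite ge0_fin_numE.
  rewrite (_ : (fun r => _) = EFin \o fun r => fine (nu `]-oo, r]%classic)); last first.
    by apply/funext => r /=; rewrite fineK.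
  apply/measurable_EFinP; apply: nondecreasing_measurable => // r r' rr'.
  by rewrite fine_le// nu_mono.
have mnu2 r : measurable_fun [set: R] (fun x : R => nu `]-oo, (r - x ^+ 2)%R]%classic).
  by apply: (measurableT_comp mnu); exact: measurable_funB.
have mucdf_fin r : mu `]-oo, r]%classic < +oo.
  rewrite mu_cdf.
  (* If x^2 <= r then |x| <= r^2 + 1, so the integrand vanishes elsewhere. *)
  apply: (@le_lt_trans _ _
      (\int[leb]_(x in `[(- (r ^+ 2 + 1))%R, (r ^+ 2 + 1)%R])
         nu `]-oo, r]%classic)).
    rewrite [leRHS]integral_mkcond; apply: ge0_le_integral => //.
    - exact: mnu2.
    - by apply/measurable_restrict => //; exact: measurable_cst.
    - move=> x _; rewrite patchE; case: ifPn => [_|].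
        by apply: nu_mono; rewrite gerBl sqr_ge0.
      rewrite notin_setE/= in_itv/= => /negP; rewrite negb_and -!ltNge => xr.
      rewrite nu_neg// subr_lt0.
      have r_lt : (r < r ^+ 2 + 1)%R by have := sqr_ge0 (r - 2^-1)%R; nra.
      have s_ge1 : (1 <= r ^+ 2 + 1)%R by rewrite lerDr sqr_ge0.
      rewrite (lt_le_trans r_lt)//; move: (r ^+ 2 + 1)%R s_ge1 xr => s1 s1_ge1 xr.
      by case/orP: xr => xr; nra.
  have finI : leb `[(- (r ^+ 2 + 1))%R, (r ^+ 2 + 1)%R]%classic < +oo.
    by rewrite lebesgue_measure_itv/=; case: ifPn => _; rewrite -?EFinD ltry.
  by rewrite integral_cst// lte_mul_pinfty// ge0_fin_numE.
have mufin : sigma_finite setT mu.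
  exists (fun n => `]-oo, n%:R]%classic).
    apply/seteqP; split => // x _; exists (Num.truncn `|x|).+1 => //=.
    by rewrite in_itv/= (le_trans (ler_norm _))// ltW// truncnS_gt.
  by move=> n; split => //; exact: mucdf_fin.
exists (with_sigma_finite mufin : {sigma_finite_measure set T -> \bar R}); split => //.
- move=> g mg g0; rewrite muE// /=; apply: eq_integral => x _.
  rewrite -(nuE (fun y => g (x ^+ 2 + y)%R))//; last first.
    by apply: (measurableT_comp mg); exact: measurable_funD.
  apply: eq_lebesgue_int => y; congr g.
  by rewrite (@sqnorm_row_mx _ 1 m) {1}/sqnorm big_ord1 mxE.
- move=> r r0; rewrite /= mu_cdf integral0_eq// => x _.
  by rewrite nu_neg// (le_lt_trans _ r0)// gerBl sqr_ge0.
- move=> c r c0; rewrite /= !mu_cdf.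
  rewrite (integral_lebesgue_scale c0)//.
  rewrite [in RHS]exprS EFinM -muleA; congr (_ * _).
  rewrite -ge0_integralZl_total ?exprn_gt0//.
  by apply: eq_integral => x _; rewrite exprMn -mulrBr nuZ.
Qed.

End radial.

Section integral_density.
Context d (T : measurableType d) (R : realType).
Local Open Scope ereal_scope.

Import HBNNSimple.

(** The change of variables for a measure given by a density is proved for
    indicators by hypothesis, then for simple functions by linearity and in
    general by monotone convergence. *)
Lemma ge0_integral_density (nu mu : {measure set T -> \bar R})
    (f g : T -> \bar R) :
  measurable_fun [set: T] f -> (forall x, 0 <= f x) ->
  (forall x, f x \is a fin_num) ->
  (forall A, measurable A -> nu A = \int[mu]_(x in A) f x) ->
  measurable_fun [set: T] g -> (forall x, 0 <= g x) ->
  \int[nu]_x g x = \int[mu]_x (g x * f x).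
Proof.
move=> mf f0 ffin nuE mg g0.
pose h := nnsfun_approx measurableT mg.
have gE x : g x = lim ((EFin \o h n) x @[n --> \oo]).
  by apply/esym/cvg_lim => //; exact: cvg_nnsfun_approx.
have hnd x : nondecreasing_seq (fun n => h n x).
  by move=> a b ab; exact/lefP/nd_nnsfun_approx.
transitivity (lim (\int[nu]_x (EFin \o h n) x @[n --> \oo])).
  under eq_integral do rewrite gE.
  apply: monotone_convergence => //.
  - by move=> n; apply/measurable_EFinP; exact/measurable_funP.
  - by move=> n x _ /=; rewrite lee_fin.
  - by move=> x _ a b ab; rewrite lee_fin; exact: hnd.
transitivity (lim (\int[mu]_x ((EFin \o h n) x * f x) @[n --> \oo])); last first.
  have gfE x : g x * f x = lim (((EFin \o h n) x * f x) @[n --> \oo]).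
    apply/esym/cvg_lim => //; apply: cvgeZr => //.
    exact: cvg_nnsfun_approx.
  under [RHS]eq_integral do rewrite gfE.
  apply/esym; apply: monotone_convergence => //.
  - move=> n; apply/emeasurable_funM => //.
    by apply/measurable_EFinP; exact/measurable_funP.
  - by move=> n x _ /=; rewrite mule_ge0 ?lee_fin.
  - by move=> x _ a b ab/=; rewrite lee_wpmul2r ?lee_fin//; exact: hnd.
apply: congr_lim; apply/funext => n.
transitivity (\int[nu]_x
   (\sum_(y \in range (h n)) (y * \1_(h n @^-1` [set y]) x)%:E)).
  by apply: eq_integral => t _; rewrite /= fimfunE -fsumEFin.
have indich r : measurable_fun [set: T] (fun x => (r * \1_(h n @^-1` [set r]) x)%:E).
  by apply: (measurable_comp measurableT) => //; exact: measurable_funM.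
rewrite ge0_integral_fsum//; last by move=> m y _; exact: nnfun_muleindic_ge0.
transitivity (\int[mu]_x (\sum_(y \in range (h n))
    (y * \1_(h n @^-1` [set y]) x)%:E * f x)); last first.
  apply: eq_integral => x _; rewrite -ge0_mule_fsuml => [|y].
    by rewrite fsumEFin // -(fimfunE _ x).
  exact: nnfun_muleindic_ge0.
rewrite ge0_integral_fsum//; last 2 first.
- by move=> y; exact: emeasurable_funM.
- by move=> m y _; rewrite mule_ge0// nnfun_muleindic_ge0.
apply: eq_fsbigr => r rhn.
under eq_integral do rewrite EFinM.
rewrite integralZl_indic_nnsfun => //.
under [RHS]eq_integral do rewrite EFinM -muleA.
rewrite ge0_integralZl//.
- under [in RHS]eq_integral do rewrite muleC.
  rewrite [in RHS](eq_integral (f \_ (h n @^-1` [set r]))); last first.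
    by move=> x xE; rewrite epatch_indic.
  by rewrite -integral_mkcond -nuE// integral_indic// setIT.
- by apply: emeasurable_funM => //; exact/measurable_EFinP.
- by move=> t _; rewrite mule_ge0 ?lee_fin.
- by move: rhn; rewrite inE => -[t _ <-]; rewrite lee_fin.
Qed.

Context (mu : {measure set T -> \bar R}) (f : T -> \bar R).
Context (mf : measurable_fun [set: T] f) (f0 : forall x, 0 <= f x).

(** The proofs about [f] are arguments so that the measure structure below can
    be inferred from the term. *)
Definition density_measure of measurable_fun [set: T] f
  & (forall x, 0 <= f x) := fun A : set T => \int[mu]_(t in A) f t.

Let density0 : density_measure mf f0 set0 = 0.
Proof. exact: integral_set0. Qed.

Let density_ge0 A : 0 <= density_measure mf f0 A.
Proof. exact: integral_ge0. Qed.

HB.instance Definition _ := isMeasure.Build _ _ _ (density_measure mf f0)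
  density0 density_ge0 (semi_sigma_additive_nng_induced mf f0).

End integral_density.

Section radial_density.
Context {R : realType}.
Local Open Scope ereal_scope.
Local Notation leb := (@lebesgue_measure R).

Lemma measure_eq_cdf (mu nu : {measure set (measurableTypeR R) -> \bar R}) :
  (forall r : R, mu `]-oo, r]%classic < +oo) ->
  (forall r, mu `]-oo, r]%classic = nu `]-oo, r]%classic) ->
  forall A : set (measurableTypeR R), measurable A -> mu A = nu A.
Proof.
move=> mufin munu A mA.
pose g n : set (measurableTypeR R) := `](- n%:R)%R, n%:R]%classic.
apply: (@measure_unique _ R (measurableTypeR R) (@ocitv R) g erefl _ _ _ mu nu) => //.
- exact: ocitvI.
- by move=> n; exists ((- n%:R)%R, n%:R).
- apply/seteqP; split => // x _.
  exists (Num.truncn `|x|).+1 => //; rewrite /g/= in_itv/=.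
  have := truncnS_gt `|x|; rewrite ltr_norml => /andP[-> /ltW ->] //.
- move=> _ [[a b] _ <-] /=.
  have [ba|ab] := leP b a; first by rewrite set_itv_ge ?measure0// bnd_simp -leNgt.
  have -> : `]a, b]%classic = `]-oo, b]%classic `\` `]-oo, a]%classic.
    apply/seteqP; split => x /=; rewrite !in_itv/=.
      by move=> /andP[ax xb]; split=> //; apply/negP; rewrite -ltNge.
    by move=> [-> /negP]; rewrite -ltNge => ->.
  have ai : `]-oo, b]%classic `&` `]-oo, a]%classic = `]-oo, a]%classic.
    by apply/setIidPr; apply: subset_itvl; rewrite bnd_simp ltW.
  rewrite !measureD//= ?ai ?munu//.
  by rewrite -munu.
- move=> n; apply: le_lt_trans (mufin n%:R).
  apply: le_measure; rewrite ?inE//; first exact: measurable_itv.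
  by rewrite /g => x /=; rewrite !in_itv/= => /andP[].
Qed.

(** The antiderivative is singular at 0 when p < 1, hence the exhaustion of
    ]0, r] by the segments [r / (n + 2), r]. *)
Lemma integral_powR (p r : R) : (0 < p)%R -> (0 < r)%R ->
  \int[leb]_(t in `]0%R, r]) (p * t `^ (p - 1))%:E = (r `^ p)%:E.
Proof.
move=> p0 r0.
pose S n := `[(r / n.+2%:R)%R, r]%classic.
have Sr n : (0 < r / n.+2%:R < r)%R.
  by rewrite divr_gt0//= ltr_pdivrMr// ltr_pMr// ltr1n.
have -> : `]0%R, r]%classic = \bigcup_n S n.
  apply/seteqP; split => x /=; rewrite ?in_itv/=.
    move=> /andP[x0 xr]; exists (Num.truncn (r / x)) => //=.
    rewrite /S/= in_itv/= xr andbT ler_pdivrMr// mulrC -ler_pdivrMr//.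
    by rewrite (le_trans (ltW (truncnS_gt _)))// ler_nat.
  move=> [n _]; rewrite /S/= in_itv/= => /andP[rx ->]; rewrite andbT.
  by rewrite (lt_le_trans _ rx)//; case/andP: (Sr n).
have cont_powR (q x : R) : (0 < x)%R -> {for x, continuous (fun t : R => (t `^ q)%R)}.
  move=> x0; apply: differentiable_continuous; apply/derivable1_diffP.
  by apply: derivable_powR; rewrite in_itv/= x0.
have SE n : \int[leb]_(t in S n) (p * t `^ (p - 1))%:E =
    (r `^ p - (r / n.+2%:R) `^ p)%:E.
  have /andP[a0 ar] := Sr n.
  rewrite (@continuous_FTC2 R _ (fun t : R => (t `^ p)%R))//.
  - apply: continuous_in_subspaceT => x; rewrite inE/= in_itv/= => /andP[ax _].
    apply: (@continuousM _ _ (fun=> p) (fun t : R => (t `^ (p - 1))%R)); first exact: cst_continuous.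
    by apply: (cont_powR (p - 1)%R x); rewrite (lt_le_trans a0).
  - split.
    + move=> x; rewrite in_itv/= => /andP[ax _]; apply: derivable_powR.
      by rewrite in_itv/= andbT (lt_trans a0).
    + by apply: cvg_at_right_filter; exact: (cont_powR p).
    + by apply: cvg_at_left_filter; exact: (cont_powR p).
  - move=> x; rewrite in_itv/= => /andP[ax xr].
    by rewrite powR_derive1// in_itv/= andbT (lt_trans a0).
have : \int[leb]_(t in S n) (p * t `^ (p - 1))%:E @[n --> \oo] -->
    \int[leb]_(t in \bigcup_n S n) (p * t `^ (p - 1))%:E.
  apply: ge0_nondecreasing_set_cvg_integral => //.
  - apply/nondecreasing_seqP => n; apply/subsetPset/subset_itvr; rewrite bnd_simp.
    by rewrite ler_pM2l// lef_pV2 ?posrE// ler_nat.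
  - by move=> n; exact: measurable_itv.
  - move=> n; apply/measurable_funTS/measurable_EFinP; apply: measurable_funM => //.
  - by move=> n x _; rewrite lee_fin mulr_ge0 ?powR_ge0// ltW.
move/cvg_unique; apply => //.
rewrite (_ : (fun n => _) = EFin \o (fun n => r `^ p - (r / n.+2%:R) `^ p)%R); last first.
  by apply/funext => n; rewrite [LHS]SE.
apply/cvg_EFin; first by near=> n.
rewrite -[X in _ --> X]subr0; apply: cvgB; first exact: cvg_cst.
apply: ((cvg_at_rightP _ _ _).1 (powR_cvg0 p0)); split.
  by move=> n; case/andP: (Sr n).
rewrite -[X in _ --> X](mulr0 r); apply: cvgMl_tmp.
by have := @cvg_harmonic R; rewrite -cvg_shiftS.
Unshelve. all: by end_near. Qed.

End radial_density.

Section radial_law.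
Context {R : realType}.
Local Open Scope ereal_scope.
Local Notation leb := (@lebesgue_measure R).

Lemma lebesgue_int_gauss m :
  lebesgue_int (fun y : 'rV[R]_m => (expR (- sqnorm y))%:E) =
  (Num.sqrt pi ^+ m)%:E.
Proof.
elim: m => [|m IHm] /=; first by rewrite /sqnorm big_ord0 oppr0 expR0 expr0.
transitivity (\int[leb]_x ((Num.sqrt pi ^+ m)%:E * (gauss_fun x)%:E)).
  apply: eq_integral => x _; rewrite -IHm muleC -lebesgue_intZl ?expR_gt0//.
  apply: eq_lebesgue_int => y; rewrite (@sqnorm_row_mx _ 1 m) {1}/sqnorm big_ord1 mxE.
  by rewrite opprD expRD EFinM.
rewrite ge0_integralZl//.
- by rewrite integralT_gauss exprSr EFinM.
- by apply/measurable_EFinP; exact: measurable_gauss_fun.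
- by move=> x _; rewrite lee_fin gauss_fun_ge0.
Qed.

(** By dilation the distribution function of the squared norm is k r^(m/2) with
    k the volume of the unit ball, hence a density k p h^(p - 1) with p = m/2.
    Integrating exp(-|y|^2) over R^m gives pi^p on one side and k p Gamma(p) on
    the other, which evaluates k p. *)
Lemma radial_law m : (0 < m)%N ->
  let p : R := (m%:R / 2)%R in
  (0 < Gamma p)%R /\
  forall A : set (measurableTypeR R), measurable A ->
    lebesgue_int (fun y : 'rV[R]_m => (\1_A (sqnorm y))%:E) =
    \int[leb]_(h in `[0%R, +oo[)
      (pi `^ p / Gamma p * h `^ (p - 1) * \1_A h)%:E.
Proof.
move=> m0 p; have p0 : (0 < p)%R by rewrite divr_gt0// ltr0n.
have [nu [nuE nu_neg nu_fin nuZ]] := @radial_measure R m.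
pose k := fine (nu `]-oo, 1%R]%classic).
have k0 : (0 <= k)%R by exact: fine_ge0.
have nu1 : nu `]-oo, 1%R]%classic = k%:E by rewrite fineK// ge0_fin_numE.
have nu_pos (r : R) : (0 < r)%R -> nu `]-oo, r]%classic = (k * r `^ p)%:E.
  move=> r0; have s0 : (0 < Num.sqrt r)%R by rewrite sqrtr_gt0.
  have := nuZ _ 1%R s0; rewrite mulr1 sqr_sqrtr ?ltW// nu1 => ->.
  by rewrite -EFinM mulrC -powR12_sqrt ?ltW// -powR_mulrn ?powR_ge0// -powRrM /p (mulrC 2^-1%R).
(* The dilation by 2 fixes 0, so a mass x at 0 satisfies x = 2^m x. *)
have nu0 : nu `]-oo, 0%R]%classic = 0.
  have fin0 : nu `]-oo, 0%R]%classic \is a fin_num by rewrite ge0_fin_numE.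
  have := nuZ 2%R 0%R (ltr0Sn R 1); rewrite mulr0 -(fineK fin0) => -[H].
  congr (_%:E); have : (1 < 2 ^+ m :> R)%R by rewrite exprn_egt1// ?ltr1n// gt_eqF.
  by move: H; move: (fine _) (2 ^+ m)%R => x y H y1; nra.
pose f0 t : R := (k * (p * t `^ (p - 1)) * \1_(`]0%R, +oo[%classic : set R) t)%R.
pose f t := (f0 t)%:E.
have f_ge0 t : 0 <= f t by rewrite lee_fin !mulr_ge0// ?powR_ge0// ltW.
have mf : measurable_fun [set: measurableTypeR R] f.
  apply/measurable_EFinP; apply: measurable_funM; last exact: measurable_indic.
  by do 2 apply: measurable_funM => //.
have nu_f (A : set (measurableTypeR R)) : measurable A -> nu A = \int[leb]_(t in A) f t.
  apply: (measure_eq_cdf (nu := density_measure leb mf f_ge0)) => // r.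
  rewrite /= /density_measure.
  have [r0|r0] := leP r 0%R.
    rewrite integral0_eq => [|x /=]; last first.
      rewrite in_itv/= => xr.
      rewrite /f /f0 indicE memNset ?mulr0//= in_itv/= andbT; apply/negP.
      by rewrite -leNgt (le_trans xr).
    by apply/eqP; rewrite -measure_le0 -nu0 le_measure ?inE//; apply: subset_itvl; rewrite bnd_simp.
  rewrite nu_pos//.
  transitivity (\int[leb]_(t in `]0%R, r]) (k%:E * (p * t `^ (p - 1))%:E)).
    rewrite ge0_integralZl ?integral_powR//.
    - apply/measurable_funTS/measurable_EFinP; apply: measurable_funM => //.
    - by move=> x _; rewrite lee_fin mulr_ge0 ?powR_ge0// ltW.
  rewrite [LHS]integral_mkcond [RHS]integral_mkcond; apply: eq_integral => x _.
  rewrite !patchE /f /f0 indicE !mem_setE !in_itv/= andbT.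
  case: (ltP 0%R x) => x0 /=; last by rewrite mulr0 if_same.
  by rewrite mulr1.
have gaussE : (pi `^ p)%:E = (k * p)%:E *
    \int[leb]_(t in `]0%R, +oo[) (t `^ (p - 1) * expR (- t))%:E.
  have -> : (pi `^ p = Num.sqrt pi ^+ m :> R)%R.
    by rewrite -powR12_sqrt ?pi_ge0// -powR_mulrn ?powR_ge0// -powRrM /p (mulrC 2^-1%R).
  rewrite -lebesgue_int_gauss (nuE (fun t => (expR (- t))%:E)); last 2 first.
  - by apply/measurable_EFinP; apply: measurableT_comp.
  - by move=> x; rewrite lee_fin expR_ge0.
  rewrite (ge0_integral_density mf f_ge0 _ nu_f)//; last first.
    by apply/measurable_EFinP; apply: measurableT_comp.
  rewrite -ge0_integralZl//; last 3 first.
  - apply/measurable_funTS/measurable_EFinP; apply: measurable_funM => //.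
    by apply: measurableT_comp.
  - by move=> x _; rewrite lee_fin mulr_ge0 ?powR_ge0 ?expR_ge0.
  - by rewrite lee_fin mulr_ge0// ltW.
  rewrite [RHS]integral_mkcond; apply: eq_integral => x _.
  rewrite !patchE /f /f0 indicE mem_setE in_itv/= andbT.
  case: (ltP 0%R x) => x0; last by rewrite mulr0 mule0.
  by rewrite mulr1 -!EFinM; congr _%:E; ring.
pose G := \int[leb]_(t in `]0%R, +oo[) (t `^ (p - 1) * expR (- t))%:E.
have pip : (0 < pi `^ p :> R)%R by rewrite powR_gt0// pi_gt0.
have kp : (0 < k * p)%R.
  rewrite lt_neqAle eq_sym mulr_ge0// ?ltW// andbT; apply/eqP => kp0.
  by move: gaussE pip; rewrite kp0 mul0e => -[->]; rewrite ltxx.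
have GE : G = (pi `^ p / (k * p))%:E.
  rewrite mulrC EFinM gaussE muleA -EFinM mulVf ?gt_eqF// mul1e.
  by [].
have GaE : Gamma p = (pi `^ p / (k * p))%R by rewrite /Gamma /Rintegral -/G GE.
split; first by rewrite GaE divr_gt0.
move=> A mA; rewrite (nuE (fun t => (\1_A t)%:E)); last 2 first.
- by apply/measurable_EFinP; exact: measurable_indic.
- by move=> x; rewrite lee_fin.
transitivity (nu A); first by rewrite integral_indic// setIT.
rewrite nu_f// -[RHS]integral_itv_obnd_cbnd; last first.
  by apply/measurable_funTS/measurable_EFinP; do 2 apply: measurable_funM => //.
rewrite [LHS]integral_mkcond [RHS]integral_mkcond; apply: eq_integral => x _.
rewrite !patchE /f /f0 !indicE mem_setE in_itv/= andbT.
have -> : (pi `^ p / Gamma p = k * p)%R.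
  by rewrite GaE invfM invrK mulrA divff ?gt_eqF// mul1r.
case: (ltP 0%R x) => x0; last by rewrite mulr0 if_same.
by case: ifPn => xA; rewrite ?mulr0// !mulr1 mulrA.
Qed.

End radial_law.

(** * The radial map and the intensity of the image process *)
Section borel_preimage.
Context {R : realType}.

Lemma borel_preimage (T U : topologicalType) (f : T -> U) (B : set U) :
  continuous f -> borel B -> borel (f @^-1` B).
Proof.
move=> cf; move: B; apply: smallest_sub => [|B oB]; last first.
  by apply: sub_sigma_algebra; apply: open_comp oB => x _; exact: cf.
split.
- by rewrite /= preimage_set0; exact: sigma_algebra0.
- by move=> B fB; rewrite /= setTD preimage_setC -setTD; exact: sigma_algebraCD.
- by move=> F fF; rewrite /= preimage_bigcup; exact: sigma_algebra_bigcup.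
Qed.

Lemma borel_measurableR (A : set R) :
  borel A -> measurable (A : set (measurableTypeR R)).
Proof.
by apply: smallest_sub => [|B]; [exact: sigma_algebra_measurable|exact: open_measurable].
Qed.

End borel_preimage.

Section radial_map.
Context {R : realType} (l m : nat).

Definition radial_map (x : 'rV[R]_(l + m)) : 'rV[R]_l * R :=
  (lsubmx x, sqnorm (rsubmx x)).

Lemma pair_continuous (v : 'rV[R]_l) : continuous (fun h : R => (v, h)).
Proof.
move=> h; apply: (@cvg_pair _ _ _ (nbhs h) (nbhs v) (nbhs h)).
  exact: cvg_cst.
exact: cvg_id.
Qed.

Lemma lsubmx_continuous : continuous (@lsubmx R 1 l m).
Proof.
move=> x A /nbhs_ballP[e e0 eA]; apply/nbhs_ballP; exists e => // y [_ xy].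
by apply: eA; split => // i j; rewrite !mxE; exact: xy.
Qed.

Lemma sqnorm_continuous n : continuous (@sqnorm R n).
Proof.
apply: continuous_big => [|i _ x]; first exact: add_continuous.
apply: (@continuous_comp _ _ _ (fun x : 'rV[R]_n => x 0 i) (fun t => t ^+ 2)).
  exact: coord_continuous.
exact: exprn_continuous.
Qed.

Lemma rsubmx_sqnorm_continuous : continuous (fun x : 'rV[R]_(l + m) => sqnorm (rsubmx x)).
Proof.
have -> : (fun x : 'rV[R]_(l + m) => sqnorm (rsubmx x)) =
    (fun x => \sum_(i < m) x 0 (rshift l i) ^+ 2).
  by apply/funext => x; apply: eq_bigr => i _; rewrite mxE.
apply: continuous_big => [|i _ x]; first exact: add_continuous.
apply: (@continuous_comp _ _ _ (fun x : 'rV[R]_(l + m) => x 0 (rshift l i)) (fun t => t ^+ 2)).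
  exact: coord_continuous.
exact: exprn_continuous.
Qed.

Lemma radial_map_continuous : continuous radial_map.
Proof.
move=> x.
apply: (@cvg_pair _ _ _ (nbhs x) (nbhs (lsubmx x)) (nbhs (sqnorm (rsubmx x)))).
  exact: lsubmx_continuous.
exact: rsubmx_sqnorm_continuous.
Qed.

Local Open Scope ereal_scope.
Local Notation leb := (@lebesgue_measure R).

Lemma beta_densityE (rho h : R) : (0 < m)%N ->
  beta_density l (((l + m)%:R - l%:R) / 2 - 1)
    (pi `^ ((l + m).+1%:R / 2) * rho / Gamma ((l + m).+1%:R / 2)) h =
  (rho * (pi `^ (m%:R / 2) / Gamma (m%:R / 2) * h `^ (m%:R / 2 - 1)))%R.
Proof.
move=> m0; rewrite /beta_density.
have -> : (((l + m)%:R - l%:R) / 2 - 1 = m%:R / 2 - 1 :> R)%R.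
  by rewrite natrD addrAC subrr add0r.
have -> : (l.+1%:R / 2 + (m%:R / 2 - 1) + 1 = (l + m).+1%:R / 2 :> R)%R.
  by rewrite -addrA subrK -mulrDl -natrD addSn.
have -> : ((m%:R / 2 - 1 + 1) = m%:R / 2 :> R)%R by rewrite subrK.
have -> : (pi `^ ((l + m).+1%:R / 2) = pi `^ (l.+1%:R / 2) * pi `^ (m%:R / 2) :> R)%R.
  rewrite -powRD; last by rewrite gt_eqF ?pi_gt0 ?implybT.
  by rewrite -mulrDl -natrD addSn.
have [G1 _] := @radial_law R _ m0.
have [G2 _] := @radial_law R (l + m).+1 isT.
have pil : (pi `^ (l.+1%:R / 2) != 0 :> R)%R by rewrite gt_eqF// powR_gt0// pi_gt0.
by field; rewrite pil !gt_eqF.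
Qed.

(** Fibre by fibre over v in R^l, this is [radial_law] applied to the section of
    C at v. *)
Lemma intensity_radial_map (rho : R) (C : set ('rV[R]_l * R)%type) :
  (0 < m)%N -> (0 < rho)%R -> borel C ->
  rho%:E * lebesgue_int (fun x => (\1_(radial_map @^-1` C) x)%:E) =
  lebesgue_int (fun v : 'rV[R]_l => \int[leb]_(h in `[0%R, +oo[)
    (beta_density l (((l + m)%:R - l%:R) / 2 - 1)
      (pi `^ ((l + m).+1%:R / 2) * rho / Gamma ((l + m).+1%:R / 2)) h
     * \1_C (v, h))%:E).
Proof.
move=> m0 rho0 bC; rewrite lebesgue_int_split -lebesgue_intZl//; last first.
  by move=> v; apply: lebesgue_int_ge0 => y; rewrite lee_fin.
apply: eq_lebesgue_int => v.
pose A : set (measurableTypeR R) := (fun h : R => (v, h)) @^-1` C.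
have mA : measurable A.
  by apply: borel_measurableR; apply: borel_preimage bC; exact: pair_continuous.
have [G1 /(_ A mA) radE] := @radial_law R _ m0.
transitivity (rho%:E * lebesgue_int (fun y : 'rV[R]_m => (\1_A (sqnorm y))%:E)).
  congr (_ * _); apply: eq_lebesgue_int => y; congr (_%:E).
  rewrite !indicE; congr (_%:R); congr nat_of_bool.
  by apply/idP/idP; rewrite !inE /radial_map/= row_mxKl row_mxKr.
rewrite radE -ge0_integralZl//; last 3 first.
- by apply/measurable_funTS/measurable_EFinP; do 2 apply: measurable_funM => //.
- by move=> x _; rewrite lee_fin !mulr_ge0// ?powR_ge0// invr_ge0 ltW.
- by rewrite lee_fin ltW.
apply: eq_integral => h _; rewrite beta_densityE// -EFinM; congr (_%:E).
have -> : (\1_C (v, h) = \1_A h :> R)%R.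
  by rewrite !indicE; congr (_%:R); congr nat_of_bool; apply/idP/idP; rewrite !inE.
by rewrite !mulrA.
Qed.

End radial_map.

(** * Laws of random locally finite measures *)
Section lfmeasure.
Context d (T : measurableType d) (R : realType) (K : nat -> set T).
Local Open Scope ereal_scope.

(** Measures that are finite on each K n. In the application K n are compact
    sets exhausting the space. *)
Record lfmeasure := LFMeasure {
  lfmeasure_val :> {measure set T -> \bar R} ;
  lfmeasure_fin : forall n, lfmeasure_val (K n) < +oo }.

Let mzero_fin n : (@mzero d T R : {measure set T -> \bar R}) (K n) < +oo.
Proof. exact: ltry. Qed.

HB.instance Definition _ := gen_eqMixin lfmeasure.
HB.instance Definition _ := gen_choiceMixin lfmeasure.
HB.instance Definition _ := isPointed.Build lfmeasure (LFMeasure mzero_fin).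

(** Finite-dimensional events are used as generators, rather than the events
    about a single set, because they are stable under intersection. *)
Definition lf_events : set (set lfmeasure) :=
  [set E | exists n (B : 'I_n -> set T) (A : 'I_n -> set (\bar R)),
    [/\ forall i, measurable (B i), forall i, measurable (A i) &
        E = [set mu : lfmeasure | forall i, A i (mu (B i))]]].

Definition lfspace := g_sigma_algebraType lf_events.

Lemma lf_eventsI : setI_closed lf_events.
Proof.
move=> _ _ [n1 [B1 [A1 [mB1 mA1 ->]]]] [n2 [B2 [A2 [mB2 mA2 ->]]]].
pose glue X (F1 : 'I_n1 -> X) (F2 : 'I_n2 -> X) (i : 'I_(n1 + n2)) :=
  match fintype.split i with inl j => F1 j | inr k => F2 k end.
exists (n1 + n2)%N, (glue _ B1 B2), (glue _ A1 A2); split.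
- by move=> i; rewrite /glue; case: fintype.split.
- by move=> i; rewrite /glue; case: fintype.split.
- apply/seteqP; split => mu /=.
    by move=> [h1 h2] i; rewrite /glue; case: fintype.split.
  move=> h; split => i.
    by have := h (lshift n2 i); rewrite /glue (unsplitK (inl i : 'I_n1 + 'I_n2)).
  by have := h (rshift n1 i); rewrite /glue (unsplitK (inr i : 'I_n1 + 'I_n2)).
Qed.

Lemma lf_eventsT : lf_events setT.
Proof.
exists 0%N, (fun=> setT), (fun=> setT); split => //.
by apply/seteqP; split => // mu _ [].
Qed.

Lemma measurable_lf_eval (B : set T) : measurable B ->
  measurable_fun [set: lfspace] (fun mu : lfspace => (mu : lfmeasure) B).
Proof.
move=> mB _ A mA; rewrite setTI; apply: sub_sigma_algebra.
exists 1%N, (fun=> B), (fun=> A); split => //.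
by apply/seteqP; split => mu /= h; [move=> _; exact: h|exact: (h ord0)].
Qed.

Lemma measurable_to_lfspace d' (O : measurableType d') (mu : O -> lfspace) :
  (forall B, measurable B -> measurable_fun [set: O] (fun w => (mu w : lfmeasure) B)) ->
  measurable_fun [set: O] mu.
Proof.
move=> mmu; apply: (@measurability _ _ O lfspace setT mu lf_events) => //.
move=> _ [E [n [B [A [mB mA ->]]]] <-]; rewrite setTI.
have -> : mu @^-1` [set m : lfmeasure | forall i, A i (m (B i))] =
    \bigcap_(i in [set: 'I_n]) ((fun w => (mu w : lfmeasure) (B i)) @^-1` A i).
  by apply/seteqP; split => w /= h; [move=> i _; exact: h|move=> i; exact: h].
apply: fin_bigcap_measurable => // i _.
by rewrite -[X in measurable X]setTI; exact: mmu.
Qed.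

End lfmeasure.

Section count_law.
Context {R : realType}.
Local Open Scope ereal_scope.

(** Enumerates the possible values of a count, with +oo in position 0. *)
Definition count_value (j : nat) : \bar R :=
  if j is k.+1 then k%:R%:E else +oo.

Lemma count_value_inj : injective count_value.
Proof.
by move=> [|j] [|k] //= [] /eqP; rewrite eqr_nat => /eqP ->.
Qed.

(** Probabilities of the finite values suffice: the value +oo has the remaining
    mass. *)
Lemma law_of_count d1 (O1 : measurableType d1) (P1 : probability O1 R)
    d2 (O2 : measurableType d2) (P2 : probability O2 R)
    (N1 : O1 -> \bar R) (N2 : O2 -> \bar R) :
  measurable_fun [set: O1] N1 -> measurable_fun [set: O2] N2 ->
  (forall w, range count_value (N1 w)) -> (forall w, range count_value (N2 w)) ->
  (forall k, P1 (N1 @^-1` [set k%:R%:E]) = P2 (N2 @^-1` [set k%:R%:E])) ->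
  forall A, measurable A -> P1 (N1 @^-1` A) = P2 (N2 @^-1` A).
Proof.
move=> mN1 mN2 N1v N2v PN A mA.
have mpre d (O : measurableType d) (N : O -> \bar R) B :
    measurable_fun setT N -> measurable B -> measurable (N @^-1` B).
  by move=> mN mB; rewrite -[X in measurable X]setTI; exact: mN.
have decomp d (O : measurableType d) (P : probability O R) (N : O -> \bar R)
    (B : set nat) :
    measurable_fun setT N ->
    P (\bigcup_(j in B) N @^-1` [set count_value j]) =
    \sum_(0 <= j <oo | j \in B) P (N @^-1` [set count_value j]).
  move=> mN; rewrite measure_bigcup//.
  - by move=> j _; exact: mpre.
  - apply/trivIsetP => i j _ _ ij; apply/seteqP; split => // w [Ni Nj].
    by move/eqP: ij; apply; apply: count_value_inj; exact: etrans (esym Ni) Nj.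
have PN0 : P1 (N1 @^-1` [set count_value 0]) = P2 (N2 @^-1` [set count_value 0]).
  have compl d (O : measurableType d) (P : probability O R) (N : O -> \bar R) :
      measurable_fun setT N -> (forall w, range count_value (N w)) ->
      P (N @^-1` [set count_value 0]) =
      1 - \sum_(0 <= j <oo | j \in [set j | (0 < j)%N]) P (N @^-1` [set count_value j]).
    move=> mN Nv.
    rewrite -decomp// -probability_setC//; last first.
      by apply: bigcup_measurable => j _; exact: mpre.
    congr (P _); apply/seteqP; split => w /=.
      by move=> Nw [[|j] /= j0]; rewrite Nw.
    have [[|j] _ Nj] := Nv w; first by rewrite -Nj.
    by case; exists j.+1; rewrite //= -Nj.
  rewrite !compl//; congr (_ - _); apply: eq_eseriesr => -[|j]; rewrite inE//= => _; exact: PN.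
have PNE d (O : measurableType d) (P : probability O R) (N : O -> \bar R) :
    measurable_fun setT N -> (forall w, range count_value (N w)) ->
    P (N @^-1` A) =
    \sum_(0 <= j <oo | j \in [set j | A (count_value j)]) P (N @^-1` [set count_value j]).
  move=> mN Nv; rewrite -decomp//; congr (P _); apply/seteqP; split => w /=.
    by move=> NA; have [j _ Nj] := Nv w; exists j => //=; rewrite Nj.
  by move=> [j /=] jA ->.
by rewrite !PNE//; apply: eq_eseriesr => -[_|j _]; [exact: PN0|exact: PN].
Qed.

End count_law.

Section joint_law.
Context {R : realType}.
Local Open Scope ereal_scope.

Definition rectangles n : set (set ('I_n -> \bar R)) :=
  [set D | exists2 A : 'I_n -> set (\bar R), (forall i, measurable (A i)) &
           D = [set x | forall i, A i (x i)]].

(** The product sigma-algebra on n-tuples of extended reals. *)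
Definition evector n := g_sigma_algebraType (@rectangles n).

Lemma measurable_evector_coord n (i : 'I_n) :
  measurable_fun [set: evector n] (fun x : evector n => x i).
Proof.
move=> _ A mA; rewrite setTI; apply: sub_sigma_algebra.
exists (fun j => if j == i then A else setT); first by move=> j; case: ifP.
apply/seteqP; split => x /= h.
  by move=> j; case: eqP => // ->.
by have := h i; rewrite eqxx.
Qed.

Lemma joint_law n d1 (O1 : measurableType d1) (P1 : probability O1 R)
    d2 (O2 : measurableType d2) (P2 : probability O2 R)
    (N1 : 'I_n -> O1 -> \bar R) (N2 : 'I_n -> O2 -> \bar R) :
  (forall i, measurable_fun [set: O1] (N1 i)) ->
  (forall i, measurable_fun [set: O2] (N2 i)) ->
  (forall A : 'I_n -> set (\bar R), (forall i, measurable (A i)) ->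
    P1 (\bigcap_(i in [set: 'I_n]) (N1 i @^-1` A i)) =
    P2 (\bigcap_(i in [set: 'I_n]) (N2 i @^-1` A i))) ->
  forall D : set (evector n), measurable D ->
    P1 [set w | D (fun i => N1 i w)] = P2 [set w | D (fun i => N2 i w)].
Proof.
move=> mN1 mN2 P12.
have mvec d (O : measurableType d) (N : 'I_n -> O -> \bar R) :
    (forall i, measurable_fun [set: O] (N i)) ->
    measurable_fun [set: O] (fun w => (fun i => N i w) : evector n).
  move=> mN; apply: (@measurability _ _ O (evector n) setT _ (@rectangles n)) => //.
  move=> _ [_ [A mA ->] <-]; rewrite setTI.
  rewrite (_ : _ @^-1` _ = \bigcap_(i in [set: 'I_n]) (N i @^-1` A i)).
    apply: fin_bigcap_measurable => // i _.
    by rewrite -[X in measurable X]setTI; exact: mN.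
  by apply/seteqP; split => w /= h; [move=> i _; exact: h|move=> i; exact: h].
move=> D mD.
apply: (@measure_unique _ R (evector n) (@rectangles n) (fun=> setT) erefl _ _ _
  (image_measure P1 (mvec _ _ _ mN1)) (image_measure P2 (mvec _ _ _ mN2))) => //.
- move=> _ _ [A mA ->] [A' mA' ->]; exists (fun i => A i `&` A' i).
    by move=> i; exact: measurableI.
  by apply/seteqP; split => x /= => [[h h'] i|h]; [split|split => i; case: (h i)].
- by move=> _; exists (fun=> setT) => //; apply/seteqP; split.
- by rewrite bigcup_const.
- move=> _ [A mA ->].
  have E d (O : measurableType d) (P : probability O R) (N : 'I_n -> O -> \bar R) :
      P [set w | forall i, A i (N i w)] = P (\bigcap_(i in [set: 'I_n]) (N i @^-1` A i)).
    by congr (P _); apply/seteqP; split => w /= h; [move=> i _; exact: h|move=> i; exact: h].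
  have := P12 A mA; rewrite -!E; exact.
- by move=> _; rewrite /= /pushforward preimage_setT probability_setT ltry.
Qed.

End joint_law.

Section lf_law.
Context d (T : measurableType d) (R : realType) (K : nat -> set T).
Local Open Scope ereal_scope.
Local Notation M := (lfspace R K).

Definition completely_random d' (O : measurableType d') (P : probability O R)
    (mu : O -> M) :=
  forall n (C : 'I_n -> set T) (A : 'I_n -> set (\bar R)),
    (forall i, measurable (C i)) -> trivIset setT C ->
    (forall i, measurable (A i)) ->
    P (\bigcap_(i in [set: 'I_n]) ((fun w => (mu w : lfmeasure R K) (C i)) @^-1` A i)) =
    \big[*%E/1]_(i < n) P ((fun w => (mu w : lfmeasure R K) (C i)) @^-1` A i).

(** The points whose membership in the sets B i is exactly prescribed by J: the
    atoms of the finite algebra generated by B. *)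
Definition atom n (B : 'I_n -> set T) (J : {set 'I_n}) : set T :=
  [set x | forall i, B i x <-> i \in J].

Lemma measurable_atom n (B : 'I_n -> set T) J :
  (forall i, measurable (B i)) -> measurable (atom B J).
Proof.
move=> mB.
have -> : atom B J = \bigcap_(i in [set: 'I_n]) (if i \in J then B i else ~` B i).
  apply/seteqP; split => x /= h i.
    by move=> _; have := h i; case: ifP => _ h'; [exact/h'|move=> /h'].
  by have := h i I; case: ifP => _ h'.
apply: fin_bigcap_measurable => // i _; case: ifP => // _.
exact: measurableC.
Qed.

Lemma trivIset_atom n (B : 'I_n -> set T) : trivIset setT (atom B).
Proof.
apply/trivIsetP => J J' _ _ /eqP JJ'; apply/seteqP; split => // x [xJ xJ'].
by apply: JJ'; apply/setP => i; apply/idP/idP => [/xJ/xJ'|/xJ'/xJ].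
Qed.

Lemma bigcup_atom n (B : 'I_n -> set T) i :
  B i = \bigcup_(J in [set J : {set 'I_n} | i \in J]) atom B J.
Proof.
apply/seteqP; split => x.
  move=> Bix; exists [set j | `[< B j x >]]%SET.
    by rewrite /= inE; apply/asboolP.
  by move=> j; rewrite inE; split => /asboolP.
by move=> [J /= iJ /(_ i)[_]]; exact.
Qed.

Lemma measure_atom n (B : 'I_n -> set T) i (mu : {measure set T -> \bar R}) :
  (forall i, measurable (B i)) ->
  mu (B i) = \sum_(J : {set 'I_n} | i \in J) mu (atom B J).
Proof.
move=> mB; rewrite {1}bigcup_atom measure_fin_bigcup//.
- rewrite (@bigfs _ _ _ _ (index_enum _) (fun J : {set 'I_n} => i \in J))//.
    exact: index_enum_uniq.
  by move=> J _; rewrite mem_index_enum.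
- exact: finite_finset.
- by apply: sub_trivIset (@trivIset_atom n B).
- by move=> J _; exact: measurable_atom.
Qed.

(** Independence is given for disjoint sets only, whereas a finite-dimensional
    event involves overlapping sets B i. Each B i is a disjoint union of atoms,
    so the counts on the B i are sums of counts on the atoms, whose joint law is
    the product of the marginals. *)
Lemma lf_law_unique d1 (O1 : measurableType d1) (P1 : probability O1 R)
    d2 (O2 : measurableType d2) (P2 : probability O2 R)
    (mu1 : O1 -> M) (mu2 : O2 -> M) :
  measurable_fun [set: O1] mu1 -> measurable_fun [set: O2] mu2 ->
  (forall w B, measurable B -> range count_value ((mu1 w : lfmeasure R K) B)) ->
  (forall w B, measurable B -> range count_value ((mu2 w : lfmeasure R K) B)) ->
  (forall B k, measurable B ->
    P1 [set w | (mu1 w : lfmeasure R K) B = k%:R%:E] =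
    P2 [set w | (mu2 w : lfmeasure R K) B = k%:R%:E]) ->
  completely_random P1 mu1 -> completely_random P2 mu2 ->
  forall E, measurable E -> P1 (mu1 @^-1` E) = P2 (mu2 @^-1` E).
Proof.
move=> mmu1 mmu2 mu1v mu2v marg cr1 cr2.
have meval d' (O : measurableType d') (mu : O -> M) B :
    measurable_fun setT mu -> measurable B ->
    measurable_fun setT (fun w => (mu w : lfmeasure R K) B).
  by move=> mmu mB; apply: measurableT_comp (measurable_lf_eval mB) mmu.
move=> E mE.
apply: (@measure_unique _ R M (@lf_events _ _ R K) (fun=> setT) erefl _ _ _
  (image_measure P1 mmu1) (image_measure P2 mmu2)) => //.
- exact: lf_eventsI.
- by move=> _; exact: lf_eventsT.
- by rewrite bigcup_const.
- move=> _ [n [B [A [mB mA ->]]]].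
  pose N := #|{: {set 'I_n}}|.
  pose C (j : 'I_N) := atom B (enum_val j).
  have mC j : measurable (C j) by exact: measurable_atom.
  have tC : trivIset setT C.
    apply/trivIsetP => i j _ _ ij; have /trivIsetP := @trivIset_atom n B.
    by apply => //; apply: contra_neq ij; exact: enum_val_inj.
  pose D := [set x : evector N | forall i : 'I_n,
    A i (\sum_(j < N | i \in enum_val j) x j)%E].
  have mD : measurable (D : set (@evector R N)).
    have -> : D = \bigcap_(i in [set: 'I_n])
        ((fun x : evector N => (\sum_(j < N | i \in enum_val j) x j)%E) @^-1` A i).
      by apply/seteqP; split => w /= h; [move=> i _; exact: h|move=> i; exact: h].
    apply: fin_bigcap_measurable => // i _.
    pose S : evector N -> \bar R := fun x => \sum_(j < N | i \in enum_val j) x j.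
    have mS : measurable_fun setT S.
      have -> : S = fun x => \sum_(j < N) (if i \in enum_val j then x j else 0).
        by apply/funext => x; rewrite /S [LHS]big_mkcond.
      apply: emeasurable_sum => j /=; case: (i \in enum_val j) => //.
      exact: measurable_evector_coord.
    by rewrite -[X in measurable X]setTI; exact: mS.
  have ED d' (O : measurableType d') (P : probability O R) (mu : O -> M) :
      P (mu @^-1` [set m : lfmeasure R K | forall i, A i (m (B i))]) =
      P [set w | D (fun j => (mu w : lfmeasure R K) (C j))].
    have NE w i : (mu w : lfmeasure R K) (B i) =
        \sum_(j < N | i \in enum_val j) (mu w : lfmeasure R K) (C j).
      rewrite (@measure_atom _ B)// (reindex (fun j : 'I_N => enum_val j))//.
      by apply: onW_bij; exact: enum_val_bij.
    congr (P _); apply/seteqP; split => w /= h i; have := h i;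
      by rewrite NE.
  rewrite [LHS]ED [RHS]ED; apply: joint_law mD => //.
  + by move=> i; exact: meval.
  + by move=> i; exact: meval.
  + move=> A' mA'; rewrite cr1// cr2//; apply: eq_bigr => i _.
    apply: law_of_count => //.
    * exact: meval.
    * exact: meval.
    * by move=> w; exact: mu1v.
    * by move=> w; exact: mu2v.
    * by move=> k; exact: (marg (C i) k (mC i)).
- by move=> _; rewrite /= /pushforward preimage_setT probability_setT ltry.
Qed.

End lf_law.

(** * Properties decided by a measurable representative *)
Section tracked.
Context d (Z : measurableType d) (Y : Type) (rep : Z -> Y -> Prop).

(** The set [Q] need not live on a measurable space: it is observed through the
    elements z of [Z] that represent y, and one measurable set must give the
    right answer for all representatives. Such sets form a sigma-algebra. *)
Definition tracked (Q : set Y) : Prop :=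
  exists2 H : set Z, measurable H & forall z y, rep z y -> (H z <-> Q y).

Lemma eq_tracked (Q Q' : set Y) :
  (forall z y, rep z y -> (Q y <-> Q' y)) -> tracked Q -> tracked Q'.
Proof.
move=> QQ' [H mH HQ]; exists H => // z y zy.
by split => [/(HQ z y zy)/(QQ' z y zy)|/(QQ' z y zy)/(HQ z y zy)].
Qed.

Lemma trackedC (Q : set Y) : tracked Q -> tracked (~` Q).
Proof.
move=> [H mH HQ]; exists (~` H); first exact: measurableC.
by move=> z y zy; split=> nQ /(HQ z y zy).
Qed.

Lemma tracked_bigcup (I : countType) (F : I -> set Y) :
  (forall i, tracked (F i)) -> tracked [set y | exists i, F i y].
Proof.
move=> tF; have /all_sig[H HP] : forall i, {H : set Z | measurable H /\
    forall z y, rep z y -> (H z <-> F i y)}.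
  by move=> i; apply: cid; have [H mH HF] := tF i; exists H.
exists (\bigcup_i H i).
  apply: countable_bigcupT_measurable => [|i]; first exact: countableP.
  by case: (HP i).
move=> z y zy; split=> [[i _ Hiz]|[i Fiy]]; exists i => //.
  by have [_ /(_ z y zy)[+ _]] := HP i; exact.
by have [_ /(_ z y zy)[_]] := HP i; exact.
Qed.

Lemma tracked_bigcap (I : countType) (F : I -> set Y) :
  (forall i, tracked (F i)) -> tracked [set y | forall i, F i y].
Proof.
move=> tF; apply: (@eq_tracked (~` [set y | exists i, (~` F i) y])).
  move=> z y _; split => [nF i|Fy [i]]; last exact.
  by apply: contrapT => nFi; apply: nF; exists i.
by apply: trackedC; apply: tracked_bigcup => i; exact: trackedC.
Qed.

Lemma trackedI (Q Q' : set Y) : tracked Q -> tracked Q' -> tracked (Q `&` Q').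
Proof.
move=> tQ tQ'; apply: (@eq_tracked [set y | forall b : bool, (if b then Q else Q') y]).
  by move=> z y _; split=> [h|[Qy Q'y] []//]; split; [exact: (h true)|exact: (h false)].
by apply: tracked_bigcap => -[].
Qed.

Lemma tracked0 : tracked set0.
Proof. by exists set0. Qed.

Lemma tracked_smallest (S : Type) (f : Y -> S) (D : set S) (G : set (set S)) :
  tracked (f @^-1` D) -> (forall B, G B -> tracked (f @^-1` B)) ->
  forall B, <<s D, G >> B -> tracked (f @^-1` B).
Proof.
move=> tD tG; apply: smallest_sub => //; split.
- exact: tracked0.
- by move=> B tB; apply: trackedI => //; exact: trackedC.
- move=> F tF; apply: (@eq_tracked [set y | exists i, F i (f y)]).
    by move=> z y _; split=> [[i]|[i _]]; exists i.
  exact: tracked_bigcup.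
Qed.

End tracked.

(** * Laguerre cells and closed balls *)
Section power_of_a_point.
Context {R : realType} (l : nat).
Implicit Types (w v : 'rV[R]_l) (p q : 'rV[R]_l * R) (X : set ('rV[R]_l * R)).

(** The power of w with respect to the sphere of centre p.1 and squared radius
    -p.2. *)
Definition power w p : R := sqnorm (w - p.1) + p.2.

Definition nonneg_heights X := forall p, X p -> 0 <= p.2.

(** The error is relative as well as absolute: the powers of infinitely many
    competitors q change by unbounded amounts when w moves, but by a bounded
    proportion (see [power_perturb]). *)
Definition almost_in_cell (e : R) X p w :=
  forall q, X q -> power w p <= (1 + e) * power w q + e.

Lemma laguerre_cellE X p w :
  laguerre_cell X p w <-> forall q, X q -> power w p <= power w q.
Proof.
by split => h q Xq; have := h q Xq; rewrite /= !sqr_sqrtr ?sqnorm_ge0.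
Qed.

Lemma power_ge0 w q : 0 <= q.2 -> 0 <= power w q.
Proof. by move=> q0; rewrite addr_ge0 ?sqnorm_ge0. Qed.

Lemma power_continuous p : continuous (power ^~ p).
Proof.
move=> w; apply: (@continuousD _ _ _ (fun w => sqnorm (w - p.1)) (fun=> p.2)).
  apply: (@continuous_comp _ _ _ (fun w => w - p.1) (@sqnorm R l)).
    by apply: continuousB; [exact: cvg_id|exact: cst_continuous].
  exact: sqnorm_continuous.
exact: cst_continuous.
Qed.

Lemma sqnorm_triangle w v (t : R) : 0 < t ->
  sqnorm (w + v) <= (1 + t) * sqnorm w + (1 + t^-1) * sqnorm v.
Proof.
move=> t0; rewrite /sqnorm !mulr_sumr -big_split/= ler_sum// => i _.
rewrite mxE; move: (w 0 i) (v 0 i) => a b.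
rewrite -subr_ge0.
have -> : (1 + t) * a ^+ 2 + (1 + t^-1) * b ^+ 2 - (a + b) ^+ 2 = t^-1 * (t * a - b) ^+ 2.
  by field; rewrite gt_eqF.
by rewrite mulr_ge0 ?sqr_ge0// invr_ge0 ltW.
Qed.

(** Moving from v to w costs a factor 1 + t and an error that does not depend on
    q. Nonnegativity of the height lets the factor apply to it too. *)
Lemma power_perturb w v q (t : R) : 0 < t -> 0 <= q.2 ->
  power w q <= (1 + t) * power v q + (1 + t^-1) * sqnorm (w - v).
Proof.
move=> t0 q0; rewrite /power mulrDr addrAC lerD//.
  have -> : w - q.1 = v - q.1 + (w - v) by rewrite [RHS]addrC addrA subrK.
  exact: sqnorm_triangle.
by rewrite ler_peMl// lerDl ltW.
Qed.

Definition rat_vec (v : 'rV[rat]_l) : 'rV[R]_l := map_mx ratr v.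

Lemma rat_vec_dense w (U : set 'rV[R]_l) : nbhs w U -> exists v : 'rV[rat]_l, U (rat_vec v).
Proof.
move=> /nbhs_ballP[e e0 eU].
have /choice[f fP] : forall i : 'I_l, exists q : rat, w 0 i < ratr q < w 0 i + e.
  move=> i; have : w 0 i < w 0 i + e by rewrite ltrDl.
  by move=> /rat_in_itvoo[q]; rewrite in_itv/=; exists q.
exists (\row_i f i); apply: eU; split => // i j; rewrite !mxE ord1.
have /andP[h1 h2] := fP j.
by rewrite /ball/= ltr_distlC; apply/andP; split; [rewrite (lt_trans _ h1)// gtrBl|].
Qed.

(** The inequality for w is transported to v by perturbing the powers of both p
    and q, which gives (1 + t)^2 times the power of q plus
    (2 + t)(1 + 1/t) |v - w|^2. *)
Lemma almost_in_cell_near X p w (e : R) : 0 < e <= 1 -> nonneg_heights X -> X p ->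
  laguerre_cell X p w -> \forall v \near w, almost_in_cell e X p v.
Proof.
move=> /andP[e0 e1] X0 Xp /laguerre_cellE cw.
(* With t = e / 3 and e <= 1 we have (1 + t)^2 <= 1 + e. *)
pose t := e / 3; have t0 : 0 < t by rewrite divr_gt0.
pose s := e / ((2 + t) * (1 + t^-1)).
have c0 : 0 < (2 + t) * (1 + t^-1) by rewrite mulr_gt0 ?addr_gt0 ?invr_gt0.
have s0 : 0 < s by rewrite divr_gt0.
have cont : {for w, continuous (fun v => sqnorm (v - w))}.
  apply: (@continuous_comp _ _ _ (fun v => v - w) (@sqnorm R l)).
    by apply: continuousB; [exact: cvg_id|exact: cst_continuous].
  exact: sqnorm_continuous.
have w0 : sqnorm (w - w) < s by rewrite subrr /sqnorm big1// => i _; rewrite mxE expr0n.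
have near_w : nbhs w [set v | sqnorm (v - w) < s].
  have : nbhs (sqnorm (w - w)) [set x | x < s] by exact: lt_nbhsl.
  by move/cont.
apply: (filterS _ near_w) => v vs q Xq.
have p0 := X0 p Xp; have q0 := X0 q Xq.
have h1 := @power_perturb v w p t t0 p0.
have h2 := cw q Xq.
have h3 := @power_perturb w v q t t0 q0.
have sym : sqnorm (w - v) = sqnorm (v - w).
  by rewrite /sqnorm; apply: eq_bigr => i _; rewrite !mxE -sqrrN opprB.
have vq0 := @power_ge0 v q q0.
have h4 : (2 + t) * (1 + t^-1) * sqnorm (v - w) <= e.
  by rewrite mulrC -ler_pdivlMr// ltW.
rewrite sym in h3.
apply: (le_trans h1).
apply: (@le_trans _ _
  ((1 + t) * ((1 + t) * power v q + (1 + t^-1) * sqnorm (v - w)) +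
   (1 + t^-1) * sqnorm (v - w))).
  by rewrite lerD2r ler_pM2l ?addr_gt0// (le_trans h2).
have -> : (1 + t) * ((1 + t) * power v q + (1 + t^-1) * sqnorm (v - w)) +
  (1 + t^-1) * sqnorm (v - w) = (1 + t) ^+ 2 * power v q + (2 + t) * (1 + t^-1) * sqnorm (v - w).
  by ring.
rewrite lerD// ler_wpM2r// /t; nra.
Qed.

Lemma closed_power_le p q (a b : R) : closed [set w | power w p <= a * power w q + b].
Proof.
rewrite (_ : [set w | _] = (fun w => a * power w q + b - power w p) @^-1` [set x | 0 <= x]); last first.
  by apply/seteqP; split => x /=; rewrite subr_ge0.
apply: preimage_closed; last exact: closed_ge.
move=> x _.
apply: (@continuousB _ R^o _ (fun w => a * power w q + b) (power ^~ p)); last exact: power_continuous.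
apply: (@continuousD _ R^o _ (fun w => a * power w q) (fun=> b)); last exact: cst_continuous.
apply: (@continuousM _ _ (fun=> a) (power ^~ q)); first exact: cst_continuous.
exact: power_continuous.
Qed.

(** A point of the cell is a limit of rational points, which almost satisfy its
    inequalities by [almost_in_cell_near]. Conversely the approximate solutions
    stay in a compact ball, and each inequality passes to a cluster point. The
    right-hand side involves countably many conditions, each about one fixed
    point of R^l. *)
Lemma cell_meets_closed_ballP X p c (r : R) : nonneg_heights X -> X p ->
  (exists2 w, `|w - c| <= r & laguerre_cell X p w) <->
  forall n, exists2 v : 'rV[rat]_l, `|rat_vec v - c| <= r + n.+1%:R^-1 &
                       almost_in_cell n.+1%:R^-1 X p (rat_vec v).
Proof.
move=> X0 Xp; split.
  move=> [w wc cw] n; set e := n.+1%:R^-1.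
  have e01 : 0 < e <= 1 by rewrite invr_gt0 ltr0n invf_le1//= ler1n.
  have := @almost_in_cell_near X p w e e01 X0 Xp cw.
  have /andP[e0 _] := e01.
  have near_w : nbhs w [set v | `|v - c| <= r + e].
    have : nbhs w (ball w e) by exact: nbhsx_ballx.
    rewrite -ball_normE; apply: filterS => v /= wv.
    have -> : v - c = (v - w) + (w - c) by rewrite addrA subrK.
    by rewrite (le_trans (ler_normD _ _))// addrC lerD// distrC ltW.
  move=> /(filterI near_w)/rat_vec_dense[v [h1 h2]].
  by exists v.
move=> h; have /choice[v vP] : forall n, exists v : 'rV[rat]_l,
    `|rat_vec v - c| <= r + n.+1%:R^-1 /\ almost_in_cell n.+1%:R^-1 X p (rat_vec v).
  by move=> n; have [v ? ?] := h n; exists v.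
pose u n := rat_vec (v n).
have cball (s : R) : closed [set w : 'rV[R]_l | `|w - c| <= s].
  rewrite (_ : [set w | _] = (fun w : 'rV[R]_l => `|w - c|) @^-1` [set x | x <= s])//.
  apply: preimage_closed; last exact: closed_le.
  move=> w _; apply: (@continuous_comp _ _ _ (fun w : 'rV[R]_l => w - c) (fun w : 'rV[R]_l => `|w|)).
    by apply: continuousB; [exact: cvg_id|exact: cst_continuous].
  exact: norm_continuous.
have cK : compact [set w | `|w - c| <= r + 1].
  apply: bounded_closed_compact (cball _).
  exists (r + 1 + `|c|); split; first exact: num_real.
  move=> M rM w /= wc; rewrite (le_trans _ (ltW rM))//.
  by rewrite -{1}(subrK c w) (le_trans (ler_normD _ _))// lerD2r.
have uK : (u @ \oo) [set w | `|w - c| <= r + 1].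
  exists 0%N => // n _ /=; have [+ _] := vP n => /le_trans; apply.
  by rewrite lerD2l invf_le1// ler1n.
have [w [_ wcl]] := cK (u @ \oo) _ uK.
have inF (F : set 'rV[R]_l) n : closed F -> (forall m, (n <= m)%N -> F (u m)) -> F w.
  move=> cF uF; apply: cF => B wB; apply: wcl => //.
  by exists n.
exists w.
  apply/ler_addgt0Pr => e e0; have [n _ ne] := near_infty_natSinv_lt (PosNum e0).
  apply: (inF [set w | `|w - c| <= r + e] n) => // m nm.
  have [+ _] := vP m => /le_trans; apply; rewrite lerD2l ltW//.
  exact: ne.
apply/laguerre_cellE => q Xq; rewrite leNgt; apply/negP => qp.
have q0 := power_ge0 w (X0 q Xq).
have pq1 : 0 < power w q + 1 by rewrite ltr_wpDl.
(* If q beat p at w, any error below this e would be too small. *)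
pose e := (power w p - power w q) / (power w q + 1).
have e0 : 0 < e by rewrite divr_gt0 ?subr_gt0.
have [n _ /(_ n (leqnn n)) /= ne] := near_infty_natSinv_lt (PosNum e0).
set i := n.+1%:R^-1 in ne.
have : power w p <= (1 + i) * power w q + i.
  apply: (inF [set w | power w p <= (1 + i) * power w q + i] n) => [|m nm].
    exact: closed_power_le.
  have [_ /(_ q Xq) /le_trans] := vP m; apply.
  have im : m.+1%:R^-1 <= i by rewrite /i lef_pV2 ?posrE// ler_nat.
  by rewrite lerD// ler_wpM2r ?lerD2l// power_ge0//; exact: X0.
move: ne; rewrite /e ltr_pdivlMr// => ne.
by rewrite leNgt => /negP; apply; nra.
Qed.

End power_of_a_point.

(** * Measurable events about one Laguerre cell *)
Section represents.
Context {R : realType} (l : nat).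
Local Notation point := ('rV[R]_l * R)%type.
Local Notation T := (g_sigma_algebraType (@open point)).

Definition box (n : nat) : set T := [set p : point | `|p.1| <= n%:R /\ `|p.2| <= n%:R].

Local Notation M := (lfspace R box).

(** Only the null Borel sets of the measure are prescribed, so a measure with
    multiplicities represents its set of points as well as the counting measure
    does. *)
Definition represents (mu : M) (X : set point) : Prop :=
  nonneg_heights X /\
  forall A : set point, borel A -> ((mu : lfmeasure R box) A = 0%E <-> X `&` A = set0).

(** For statements about the cell of a distinguished point of the set. *)
Definition represents_at (z : M * T) (y : set point * point) : Prop :=
  [/\ represents z.1 y.1, z.2 = y.2 & y.1 y.2].

Local Notation tracked_at := (tracked represents_at).

Lemma tracked_const d (Z : measurableType d) (Y : Type) (rep : Z -> Y -> Prop)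
    (P : Prop) (Q : set Y) : (P -> tracked rep Q) -> tracked rep [set y | P /\ Q y].
Proof.
move=> tQ; have [p|np] := pselect P.
  by apply: eq_tracked (tQ p) => z y _; split=> // -[].
by apply: eq_tracked (tracked0 rep) => z y _; split=> // -[].
Qed.

Lemma tracked_at_exists (A : set point) : borel A ->
  tracked_at [set y | exists2 q, y.1 q & A q].
Proof.
move=> bA; exists [set z | (z.1 : lfmeasure R box) A != 0%E].
  have mev : measurable_fun [set: M * T] (fun z => (z.1 : lfmeasure R box) A).
    apply: (measurableT_comp (f := fun m : M => (m : lfmeasure R box) A)) => //.
    exact: measurable_lf_eval.
  rewrite (_ : [set z | _] = (fun z : M * T => (z.1 : lfmeasure R box) A) @^-1` (~` [set 0%E])); last first.
    by apply/seteqP; split => z /= /eqP.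
  by rewrite -[X in measurable X]setTI; apply: mev => //; exact: measurableC.
move=> z y [[_ /(_ A bA) zA] _ _]; split => /=.
  move=> /eqP zA0; apply: contrapT => nq; apply: zA0; apply/zA.
  by apply/seteqP; split => // q [yq Aq]; apply: nq; exists q.
move=> [q yq Aq]; apply/eqP => /zA/seteqP[+ _].
by move=> /(_ q (conj yq Aq)).
Qed.

Lemma tracked_at_point (A : set point) : borel A -> tracked_at [set y | A y.2].
Proof.
move=> bA; exists (snd @^-1` A).
  by rewrite -[X in measurable X]setTI; exact: measurable_snd.
by move=> z y [_ /= -> _].
Qed.

Lemma borel_power w (A : set R) : open A -> borel ((fun q : point => power w q) @^-1` A).
Proof.
move=> oA; apply: sub_sigma_algebra; apply: open_comp oA => p _.
apply: (@continuousD _ R^o _ (fun q : point => sqnorm (w - q.1)) snd); last exact: cvg_snd.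
apply: (@continuous_comp _ _ _ (fun q : point => w - q.1) (@sqnorm R l)).
  by apply: continuousB; [exact: cst_continuous|exact: cvg_fst].
exact: sqnorm_continuous.
Qed.

(** The negation says that some q violates the inequality; a rational number s
    between its two sides decouples p from q, so that the condition on q is that
    a fixed Borel set contains a point of the process. *)
Lemma tracked_at_almost_in_cell (e : R) w : 0 < e ->
  tracked_at [set y | almost_in_cell e y.1 y.2 w].
Proof.
move=> e0.
apply: (@eq_tracked _ _ _ _ (~` [set y | exists s : rat,
    (ratr s < power w y.2) /\ exists2 q, y.1 q & (1 + e) * power w q + e < ratr s])).
  move=> z y _; split => /= [ns q yq|h [s [sp [q yq qs]]]].
    rewrite leNgt; apply/negP => /rat_in_itvoo[s]; rewrite in_itv/= => /andP[h1 h2].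
    by apply: ns; exists s; split => //; exists q.
  by have := h q yq; rewrite leNgt (lt_trans qs sp).
apply: trackedC; apply: tracked_bigcup => s.
apply: (@trackedI _ _ _ _ [set y | ratr s < power w y.2]
  [set y | exists2 q, y.1 q & (1 + e) * power w q + e < ratr s]).
  apply: (@tracked_at_point [set p | ratr s < power w p]).
  by apply: (@borel_power w [set x | ratr s < x]); exact: open_gt.
apply: (@tracked_at_exists [set q | (1 + e) * power w q + e < ratr s]).
rewrite (_ : [set q | _] = (fun q : point => power w q) @^-1` [set x | x < (ratr s - e) / (1 + e)]).
  by apply: borel_power; exact: open_lt.
have E q : (power w q < (ratr s - e) / (1 + e)) = ((1 + e) * power w q + e < ratr s).
  by rewrite ltr_pdivlMr ?addr_gt0// ltrBrDr mulrC.
by apply/seteqP; split => q /=; rewrite E.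
Qed.

Lemma tracked_at_meets_closed_ball c (r : R) :
  tracked_at [set y | exists2 w, `|w - c| <= r & laguerre_cell y.1 y.2 w].
Proof.
apply: (@eq_tracked _ _ _ _ [set y | forall n, exists v : 'rV[rat]_l,
    `|rat_vec v - c| <= r + n.+1%:R^-1 /\
     almost_in_cell n.+1%:R^-1 y.1 y.2 (rat_vec v : 'rV[R]_l)]).
  move=> z y [[y0 _] _ yy]; rewrite /= cell_meets_closed_ballP//.
  split=> h n; first by have [v [? ?]] := h n; exists v.
  by have [v ? ?] := h n; exists v.
apply: tracked_bigcap => n; apply: tracked_bigcup => v.
by apply: tracked_const => _; apply: tracked_at_almost_in_cell; rewrite invr_gt0 ltr0n.
Qed.

Lemma rat_ball_sub (U : set 'rV[R]_l) (w : 'rV[R]_l) : nbhs w U ->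
  exists c s, `|w - rat_vec c| <= ratr s /\
              [set x | `|x - rat_vec c| <= ratr s] `<=` U.
Proof.
move=> /nbhs_ballP[e /= e0 eU].
have : 0 < e / 2 by rewrite divr_gt0.
move=> /rat_in_itvoo[s]; rewrite in_itv/= => /andP[s0 s1].
have /rat_vec_dense[v wv] : nbhs w (ball w (ratr s : R)) by exact: nbhsx_ballx.
have {}wv : `|w - rat_vec v| < ratr s by move: wv; rewrite -ball_normE.
exists v, s; split; first exact: ltW.
move=> x /= xv; apply: eU; rewrite -ball_normE /=.
have -> : w - x = (w - rat_vec v) - (x - rat_vec v) by rewrite opprB addrA subrK.
rewrite (le_lt_trans (ler_normB _ _))//.
by rewrite [ltRHS]splitr ltrD// (lt_trans wv, le_lt_trans xv).
Qed.

Lemma tracked_at_meets_open (U : set 'rV[R]_l) : open U ->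
  tracked_at [set y | laguerre_cell y.1 y.2 `&` U !=set0].
Proof.
move=> oU.
apply: (@eq_tracked _ _ _ _ [set y | exists cs : 'rV[rat]_l * rat,
    [set w | `|w - rat_vec cs.1| <= ratr cs.2] `<=` U /\
    exists2 w, `|w - rat_vec cs.1| <= ratr cs.2 & laguerre_cell y.1 y.2 w]).
  move=> z y _; split=> /= [[[c s]/= [csU [w wc cw]]]|[w [cw Uw]]].
    by exists w; split => //; exact: csU.
  have /rat_ball_sub[c [s [wc csU]]] : nbhs w U by exact: open_nbhs_nbhs.
  by exists (c, s); split => //; exists w.
apply: tracked_bigcup => cs; apply: tracked_const => _.
exact: tracked_at_meets_closed_ball.
Qed.

End represents.

Section hausdorff.
Context {R : realType} (l : nat).
Local Notation point := ('rV[R]_l * R)%type.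
Implicit Types (C D : set 'rV[R]_l) (F : seq 'rV[rat]_l) (e : rat).

(** The compact sets contained in the union of the closed balls of radius e about
    F and meeting each of the open ones: a countable base of the Hausdorff
    topology, written with hits and misses of open sets only. *)
Definition fits F e D : Prop :=
  [/\ nonempty_compacts D,
      ~ (D `&` [set w | forall x, x \in F -> ratr e < `|w - rat_vec x|] !=set0) &
      forall x, x \in F -> D `&` ball (rat_vec x : 'rV[R]_l) (ratr e) !=set0].

(** A crude constant is enough to compare the Euclidean norm with the sup norm
    of the topology. *)
Lemma enorm_le (x : 'rV[R]_l) : enorm x <= l.+1%:R * `|x|.
Proof.
have coord i : x 0 i ^+ 2 <= `|x| ^+ 2.
  rewrite -[leLHS]ger0_norm ?sqr_ge0// normrX lerXn2r ?nnegrE//.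
  rewrite [leRHS]mx_normrE.
  exact: (@le_bigmax _ _ _ 0 (fun ij => `|x ij.1 ij.2|) (0, i)).
rewrite -[leRHS]ger0_norm ?mulr_ge0// -sqrtr_sqr ler_wsqrtr//.
apply: (@le_trans _ _ (\sum_(i < l) `|x| ^+ 2)); first by apply: ler_sum => i _.
rewrite sumr_const card_ord -[leLHS]mulr_natl exprMn; apply: ler_wpM2r; first exact: sqr_ge0.
by rewrite -natrX ler_nat expnS expn1 (leq_trans (leqnSn l))// leq_pmulr.
Qed.

(** For C compact, F consists of the centres of finitely many balls that cover C
    and all meet it. Any set fitting the same data is within d of C, since
    two points in one ball are at sup-distance at most 2 e. *)
Lemma hausdorff_open_fits (U : set (set 'rV[R]_l)) C : hausdorff_open U -> U C ->
  exists F e, fits F e C /\ fits F e `<=` U.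
Proof.
move=> [UN Uo] UC; have [d d0 dU] := Uo C UC; have NC := UN C UC.
have [C0 cC] := NC.
have : 0 < d / (2 * l.+1%:R) by rewrite divr_gt0// mulr_gt0// ltr0n.
move=> /rat_in_itvoo[e]; rewrite in_itv/= => /andP[e0].
rewrite ltr_pdivlMr ?mulr_gt0 ?ltr0n// => ed.
have near_thick (x y c : 'rV[R]_l) : `|x - c| <= ratr e -> `|y - c| <= ratr e -> enorm (x - y) <= d.
  move=> xc yc; rewrite (le_trans (enorm_le _))// (le_trans _ (ltW ed))//.
  rewrite mulrA mulrC ler_pM2r ?ltr0n//.
  have -> : x - y = (x - c) - (y - c) by rewrite opprB addrA subrK.
  by rewrite (le_trans (ler_normB _ _))// mulr_natr mulr2n lerD.
pose D := [set x : 'rV[rat]_l | C `&` ball (rat_vec x : 'rV[R]_l) (ratr e) !=set0].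
have := cC; rewrite compact_cover => /(_ _ D (fun x => ball (rat_vec x : 'rV[R]_l) (ratr e))).
case.
- by move=> x _; exact: ball_open.
- move=> w Cw; have /rat_vec_dense[v wv] : nbhs w (ball w (ratr e : R)) by exact: nbhsx_ballx.
  exists v => /=; last exact: ball_sym.
  by exists w; split => //; exact: ball_sym.
move=> F FD CF; exists (finmap.enum_fset F), e; split.
  split => //.
  - move=> [w [Cw /= wF]]; have [x /= xF wx] := CF w Cw.
    have := wF x xF; rewrite ltNge => /negP; apply.
    by move: wx; rewrite -ball_normE /= distrC => /ltW.
  - by move=> x xF; have /set_mem := FD x xF.
move=> E [NE Eout Ein]; apply: dU => // w; last first.
  move=> Ew; have [x xF xw] : exists2 x, x \in (finmap.enum_fset F) & `|w - rat_vec x| <= ratr e.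
    apply: contrapT => nx; apply: Eout; exists w; split => //= x xF.
    by rewrite ltNge; apply/negP => wx; apply: nx; exists x.
  have /set_mem[y [Cy xy]] := FD x xF; exists y => //.
  apply: (near_thick _ _ (rat_vec x)) => //.
  by move: xy; rewrite -ball_normE /= distrC => /ltW.
move=> Cw; have [x /= xF xw] := CF w Cw.
have [y [Ey xy]] := Ein x xF; exists y => //.
by apply: (near_thick _ _ (rat_vec x)); [move: xw|move: xy];
  rewrite -ball_normE /= distrC => /ltW.
Qed.

Lemma open_norm_gt (c : 'rV[R]_l) (r : R) : open [set w | r < `|w - c|].
Proof.
rewrite (_ : [set w | _] = (fun w : 'rV[R]_l => `|w - c|) @^-1` [set t | r < t])//.
apply: open_comp; last exact: open_gt.
move=> w _.
apply: (@continuous_comp _ _ _ (fun w : 'rV[R]_l => w - c) (fun w : 'rV[R]_l => `|w|)).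
  by apply: continuousB; [exact: cvg_id|exact: cst_continuous].
exact: norm_continuous.
Qed.

Lemma open_far F e : open [set w : 'rV[R]_l | forall x, x \in F -> ratr e < `|w - rat_vec x|].
Proof.
elim: F => [|x F IH].
  by rewrite (_ : [set w | _] = setT); [exact: openT|apply/seteqP; split].
rewrite (_ : [set w | _] = [set w : 'rV[R]_l | ratr e < `|w - rat_vec x|] `&`
  [set w : 'rV[R]_l | forall x, x \in F -> ratr e < `|w - rat_vec x|]).
  by apply: openI IH; exact: open_norm_gt.
apply/seteqP; split => w /= h.
  by split=> [|y yF]; apply: h; rewrite inE ?eqxx// yF orbT.
by move=> y; rewrite inE => /predU1P[->|]; [exact: h.1|exact: h.2].
Qed.

Lemma closed_laguerre_cell (X : set point) p : closed (laguerre_cell X p).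
Proof.
rewrite (_ : laguerre_cell X p = \bigcap_(q in X) [set w | power w p <= power w q]); last first.
  by apply/seteqP; split => w /laguerre_cellE.
apply: closed_bigI => q _.
rewrite (_ : [set w | _] = [set w | power w p <= 1 * power w q + 0]); first exact: closed_power_le.
by apply/seteqP; split => w /=; rewrite mul1r addr0.
Qed.

(** For closed sets compactness is boundedness, again a condition of missing an
    open set. *)
Lemma closed_compactP C : closed C ->
  compact C <-> exists n : nat, ~ (C `&` [set w | n%:R < `|w|] !=set0).
Proof.
move=> cC; split.
  move=> /compact_bounded[M [_ /(_ (`|M| + 1))]].
  rewrite (le_lt_trans (ler_norm _)) ?ltrDl// => /(_ isT) CM.
  exists (Num.truncn (`|M| + 1)).+1 => -[w [Cw /= nw]].
  have /= := CM w Cw; rewrite leNgt => /negP; apply.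
  by rewrite (lt_trans (truncnS_gt _)).
move=> [n nC]; apply: bounded_closed_compact => //.
exists n%:R; split; first exact: num_real.
move=> M nM w Cw; rewrite /= (le_trans _ (ltW nM))// leNgt; apply/negP => nw.
by apply: nC; exists w.
Qed.

Local Notation tracked_at := (tracked (@represents_at R l)).

Lemma tracked_at_nonempty_compacts :
  tracked_at [set y | nonempty_compacts (laguerre_cell y.1 y.2)].
Proof.
apply: (@eq_tracked _ _ _ _ ([set y | laguerre_cell y.1 y.2 `&` setT !=set0] `&`
  [set y | exists n : nat, (~` [set y | laguerre_cell y.1 y.2 `&` [set w | n%:R < `|w|] !=set0]) y])).
  move=> z y _; rewrite /nonempty_compacts /= setIT closed_compactP//.
  exact: closed_laguerre_cell.
apply: trackedI; first by apply: tracked_at_meets_open; exact: openT.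
apply: tracked_bigcup => n; apply: trackedC; apply: tracked_at_meets_open.
rewrite (_ : [set w | _] = [set w : 'rV[R]_l | n%:R < `|w - 0|]).
  exact: open_norm_gt.
by apply/seteqP; split => w /=; rewrite subr0.
Qed.

Lemma tracked_at_hausdorff_borel (B : set (set 'rV[R]_l)) : hausdorff_borel B ->
  tracked_at [set y | B (laguerre_cell y.1 y.2)].
Proof.
apply: (@tracked_smallest _ _ _ _ _ (fun y => laguerre_cell y.1 y.2)).
  exact: tracked_at_nonempty_compacts.
move=> U oU; apply: (@eq_tracked _ _ _ _ [set y | exists Fe : seq 'rV[rat]_l * rat,
    fits Fe.1 Fe.2 `<=` U /\ fits Fe.1 Fe.2 (laguerre_cell y.1 y.2)]).
  move=> z y _; split => /= [[Fe [FeU /FeU]]//|Uy].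
  by have [F [e [h1 h2]]] := hausdorff_open_fits oU Uy; exists (F, e).
apply: tracked_bigcup => -[F e]; apply: tracked_const => _ /=.
apply: (@eq_tracked _ _ _ _ ([set y | nonempty_compacts (laguerre_cell y.1 y.2)] `&`
  ((~` [set y | laguerre_cell y.1 y.2 `&`
     [set w | forall x, x \in F -> ratr e < `|w - rat_vec x|] !=set0]) `&`
   [set y | forall x : 'rV[rat]_l, (~` [set y | x \in F /\
     (~` [set y | laguerre_cell y.1 y.2 `&` ball (rat_vec x : 'rV[R]_l) (ratr e) !=set0]) y]) y]))).
  move=> z y _; split => /= [[h1 [h2 h3]]|[h1 h2 h3]].
    split => // x xF; apply: contrapT => nx; exact: (h3 x).
  by split => //; split => // x [xF]; apply; exact: h3.
apply: trackedI; first exact: tracked_at_nonempty_compacts.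
apply: trackedI; first by apply: trackedC; apply: tracked_at_meets_open; exact: open_far.
apply: tracked_bigcap => x; apply: trackedC; apply: tracked_const => _.
by apply: trackedC; apply: tracked_at_meets_open; exact: ball_open.
Qed.

End hausdorff.

(** * Measurable events about the collection of cells *)
Section counting_facts.
Context {R : realType}.

Lemma counting_value (S : choiceType) (Y : set S) : range count_value (counting Y : \bar R).
Proof.
rewrite /counting; case: asboolP => _; last by exists 0%N.
by exists (size (finmap.enum_fset (fset_set Y))).+1.
Qed.

Lemma inj_of_uniq (S : eqType) (Y : set S) (s : seq S) k :
  uniq s -> (k <= size s)%N -> (forall x, x \in s -> Y x) ->
  exists2 f : 'I_k -> S, injective f & forall i, Y (f i).
Proof.
case: k => [|k] us ks sY.
  by exists (fun i : 'I_0 => False_rect S (notF (ltn_ord i))) => -[].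
have [x0 _] : exists x0, x0 \in s.
  by case: s ks {us sY} => // x s _; exists x; rewrite inE eqxx.
have ks' (i : 'I_k.+1) : (i < size s)%N by exact: leq_trans ks.
exists (fun i : 'I_k.+1 => nth x0 s i).
  by move=> i j /eqP; rewrite nth_uniq// => /eqP/val_inj.
by move=> i; apply: sY; rewrite mem_nth.
Qed.

Lemma counting_geP (S : choiceType) (Y : set S) (k : nat) :
  (k%:R%:E <= (counting Y : \bar R))%E <->
  exists2 f : 'I_k -> S, injective f & forall i, Y (f i).
Proof.
split.
  have [finY|infY] := pselect (finite_set Y).
    rewrite /counting asboolT// lee_fin ler_nat => kY.
    apply: (@inj_of_uniq _ _ (finmap.enum_fset (fset_set Y))) => //.
    by move=> x; rewrite -[_ \in _]/(x \in fset_set Y) in_fset_set// => /set_mem.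
  move=> _; have [F FY kF] := infinite_set_fset k infY.
  by apply: (@inj_of_uniq _ _ (finmap.enum_fset F)).
move=> [f fi fY]; rewrite /counting; case: asboolP => [finY|_]; last exact: leey.
rewrite lee_fin ler_nat.
pose s := [seq f i | i <- enum 'I_k].
have us : uniq s by rewrite map_inj_uniq// enum_uniq.
have <- : size s = k by rewrite size_map size_enum_ord.
apply: uniq_leq_size => // x /mapP[i _ ->].
by rewrite -[_ \in _]/(f i \in fset_set Y) in_fset_set//; exact/mem_set.
Qed.

End counting_facts.

Section tracked_config.
Context {R : realType} (l : nat).
Local Notation point := ('rV[R]_l * R)%type.
Local Notation T := (g_sigma_algebraType (@open point)).
Local Notation M := (lfspace R (@box R l)).
Local Notation tracked_at := (tracked (@represents_at R l)).
Local Notation tracked_cfg := (tracked (@represents R l)).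

Lemma closed_box n : closed (@box R l n : set point).
Proof.
rewrite /box; apply: (@closedI _ [set p : point | `|p.1| <= n%:R] [set p : point | `|p.2| <= n%:R]).
  apply: (@preimage_closed _ _ (fun p : point => `|p.1|) [set x | x <= n%:R]); last exact: closed_le.
  move=> p _; apply: (@continuous_comp _ _ _ fst (fun w : 'rV[R]_l => `|w|)); first exact: cvg_fst.
  exact: norm_continuous.
apply: (@preimage_closed _ _ (fun p : point => `|p.2|) [set x | x <= n%:R]); last exact: closed_le.
move=> p _; apply: (@continuous_comp _ _ _ snd (fun w : R => `|w|)); first exact: cvg_snd.
exact: norm_continuous.
Qed.

Lemma compact_box n : compact (@box R l n : set point).
Proof.
rewrite (_ : box n = [set w : 'rV[R]_l | `|w| <= n%:R] `*` [set x : R | `|x| <= n%:R])//.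
apply: compact_setX.
  apply: bounded_closed_compact.
    exists n%:R; split; first exact: num_real.
    by move=> x nx w /= wn; rewrite (le_trans wn)// ltW.
  apply: (@preimage_closed _ _ (fun w : 'rV[R]_l => `|w|) [set x | x <= n%:R]); last exact: closed_le.
  by move=> w _; exact: norm_continuous.
rewrite (_ : [set x | _] = `[- n%:R, n%:R]%classic); first exact: segment_compact.
by apply/seteqP; split => x /=; rewrite in_itv/= ler_norml.
Qed.

Lemma measurable_box n : measurable (@box R l n).
Proof.
rewrite -[X in measurable X]setCK; apply: measurableC.
by apply: sub_sigma_algebra; rewrite openC; exact: closed_box.
Qed.

Lemma box_cover (p : point) : exists n, box n p.
Proof.
exists (Num.truncn (`|p.1| + `|p.2|)).+1.
split; rewrite (le_trans _ (ltW (truncnS_gt _)))//.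
  by rewrite lerDl.
by rewrite lerDr.
Qed.

(** Evaluation is a kernel from the space of measures, which gives access to the
    measurability of sections. *)
Definition lf_kernel (mu : M) : {measure set T -> \bar R} := (mu : lfmeasure R (@box R l)).

HB.instance Definition _ := isKernel.Build _ _ M T R lf_kernel
  (@measurable_lf_eval _ T R (@box R l)).

(** Some point p of X has the property iff the section at mu of a measurable set
    deciding it is not null for mu. Measurability in mu of the mass of a section
    holds for kernels bounded on the sets considered, hence the boxes. *)
Lemma tracked_exists (Q : set (set point * point)) : tracked_at Q ->
  tracked_cfg [set X | exists2 p, X p & Q (X, p)].
Proof.
move=> [H mH HQ].
exists (\bigcup_n [set mu : M | (mu : lfmeasure R (@box R l)) (xsection H mu `&` box n) != 0%E]).
  apply: bigcupT_measurable => n.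
  have mk : measurable_fun [set: M] (fun mu : M => lf_kernel mu (xsection H mu `&` box n)).
    have := @measurable_prod_subset_xsection_kernel _ _ M T R lf_kernel (box n) (measurable_box n).
    move=> /(_ _ H mH)[]// mu.
    have := lfmeasure_fin (mu : lfmeasure R (@box R l)) n.
    rewrite -ge0_fin_numE// => /fineK E.
    exists (fine ((mu : lfmeasure R (@box R l)) (box n)) + 1) => X mX.
    rewrite EFinD E (@le_lt_trans _ _ ((mu : lfmeasure R (@box R l)) (box n)))//.
      apply: le_measure; last exact: subIsetr.
        by apply/mem_set; apply: measurableI => //; exact: measurable_box.
      by apply/mem_set; exact: measurable_box.
    by rewrite -E lteDl// lte_fin.
  rewrite (_ : [set mu | _] = (fun mu : M => lf_kernel mu (xsection H mu `&` box n)) @^-1` (~` [set 0%E])); last first.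
    by apply/seteqP; split => mu /= /eqP.
  by rewrite -[X in measurable X]setTI; apply: mk => //; exact: measurableC.
move=> mu X rX; have [X0 rXA] := rX.
have mA n : borel (xsection H mu `&` box n : set point).
  have : measurable (xsection H mu `&` box n : set T).
    by apply: measurableI; [exact: measurable_xsection|exact: measurable_box].
  exact.
have HP p : X p -> (xsection H mu p <-> Q (X, p)).
  move=> Xp; rewrite /xsection /= inE.
  by apply: (HQ (mu, p) (X, p)); split.
split => [[n _ /= /eqP nz]|[p Xp Qp]].
  apply: contrapT => np; apply: nz; apply/(rXA _ (mA n)).
  apply/seteqP; split => // p [Xp [Hp _]]; apply: np.
  by exists p => //; exact/HP.
have [n np] := box_cover p; exists n => //=; apply/eqP => /(rXA _ (mA n))/seteqP[+ _].
by move=> /(_ p); apply; split => //; split => //; exact/HP.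
Qed.

Lemma hausdorff_borel_sub (B : set (set 'rV[R]_l)) : hausdorff_borel B ->
  B `<=` @nonempty_compacts R l.
Proof.
pose N := [set B : set (set 'rV[R]_l) | B `<=` @nonempty_compacts R l].
suff : <<s @nonempty_compacts R l, @hausdorff_open R l >> `<=` N by apply.
apply: smallest_sub => [|U []//]; split.
- by [].
- by move=> A _ C [].
- by move=> F FN C [i _ /FN].
Qed.

End tracked_config.

Section cell_counts.
Context {R : realType} (l : nat).
Local Notation point := ('rV[R]_l * R)%type.
Local Notation tracked_at := (tracked (@represents_at R l)).
Local Notation tracked_cfg := (tracked (@represents R l)).

(** Enumerates the closed balls with rational centre and radius. *)
Definition rat_ball (i : nat) : set 'rV[R]_l :=
  if @choice.unpickle ('rV[rat]_l * rat)%type i is Some cs then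
    [set w | `|w - rat_vec cs.1| <= ratr cs.2]
  else set0.

(** A finite approximation of a closed set: which of the first n rational balls
    it meets. *)
Definition code n (C : set 'rV[R]_l) : {ffun 'I_n -> bool} :=
  [ffun i : 'I_n => `[< C `&` rat_ball i !=set0 >]].

Lemma code_separates (C D : set 'rV[R]_l) : closed C -> closed D ->
  C <> D -> exists m, forall n, (m < n)%N -> code n C <> code n D.
Proof.
have sep (F G : set 'rV[R]_l) x : closed G -> F x -> ~ G x ->
    exists m, forall n, (m < n)%N -> code n F <> code n G.
  move=> cG Fx Gx.
  have : nbhs x (~` G) by apply: open_nbhs_nbhs; split => //; exact: closed_openC.
  move=> /rat_ball_sub[c [s [xc csG]]].
  exists (choice.pickle (c, s)) => n mn /ffunP/(_ (Ordinal mn)); rewrite !ffunE /=.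
  rewrite /rat_ball choice.pickleK /= asboolT; last by exists x.
  by rewrite asboolF// => -[w [Gw /csG]].
move=> cC cD CD.
have [[x [Cx Dx]]|nx] := pselect (exists x, C x /\ ~ D x); first exact: sep Cx Dx.
have [[x [Dx Cx]]|nx'] := pselect (exists x, D x /\ ~ C x).
  have [m mP] := sep _ _ _ cC Dx Cx.
  by exists m => n mn /esym; exact: mP.
case: CD; apply/seteqP; split => x hx; apply: contrapT => h.
  by apply: nx; exists x.
by apply: nx'; exists x.
Qed.

Lemma tracked_at_code n (t : {ffun 'I_n -> bool}) :
  tracked_at [set y | code n (laguerre_cell y.1 y.2) = t].
Proof.
apply: (@eq_tracked _ _ _ _ [set y | forall i : 'I_n,
    `[< laguerre_cell y.1 y.2 `&` rat_ball i !=set0 >] = t i]).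
  move=> z y _; split => /= [h|<- i]; last by rewrite ffunE.
  by apply/ffunP => i; rewrite ffunE.
apply: tracked_bigcap => i.
have tb : tracked_at [set y | laguerre_cell y.1 y.2 `&` rat_ball i !=set0].
  rewrite /rat_ball; case: choice.unpickle => [[c s]|]; last first.
    by apply: eq_tracked (tracked0 _) => z y _; split => // -[w []].
  apply: eq_tracked (tracked_at_meets_closed_ball (rat_vec c) (ratr s)) => z y _.
  by split => [[w ? ?]|[w [? ?]]]; exists w.
case: (t i); first by apply: eq_tracked tb => z y _; split=> [/asboolP|/asboolP].
apply: eq_tracked (trackedC tb) => z y _.
by split=> /= [h|/asboolP]; [exact/asboolF|].
Qed.

(** Existence of k distinct cells cannot be expressed by k distinct points, but it
    can by k distinct codes of one length: finitely many distinct closed sets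
    have distinct codes from some length on, and equal cells have equal codes. *)
Lemma tracked_count_ge (B : set (set 'rV[R]_l)) k : hausdorff_borel B ->
  tracked_cfg [set X | (k%:R%:E <= @npoints R _ (laguerre X) B)%E].
Proof.
move=> bB.
apply: (@eq_tracked _ _ _ _ [set X | exists n : nat, exists t : {ffun 'I_k -> {ffun 'I_n -> bool}},
    injective t /\ forall i, exists2 p, X p &
      (B (laguerre_cell X p) /\ code n (laguerre_cell X p) = t i)]).
  move=> mu X _; rewrite /= /npoints counting_geP; split.
    move=> [n [t [ti tP]]].
    have /choice[p pP] : forall i, exists p, X p /\ (B (laguerre_cell X p) /\ code n (laguerre_cell X p) = t i).
      by move=> i; have [p ? ?] := tP i; exists p.
    exists (fun i => laguerre_cell X (p i)).
      move=> i j ij; apply: ti.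
      by have [_ [_ <-]] := pP i; have [_ [_ <-]] := pP j; rewrite ij.
    move=> i; have [Xp [Bp _]] := pP i; split => //; split; first by exists (p i).
    by have [/set0P/eqP] := hausdorff_borel_sub bB Bp.
  move=> [f fi fP].
  have fX i : exists2 p, X p & laguerre_cell X p = f i by have [[[p Xp pf] _] _] := fP i; exists p.
  have fc i : closed (f i) by have [p _ <-] := fX i; exact: closed_laguerre_cell.
  have /choice[m mP] : forall ij : 'I_k * 'I_k, exists m, ij.1 <> ij.2 ->
      forall n, (m < n)%N -> code n (f ij.1) <> code n (f ij.2).
    move=> [i j] /=; have [ij|ij] := pselect (i = j); first by exists 0%N.
    have [m mP] : exists m, forall n, (m < n)%N -> code n (f i) <> code n (f j).
      by apply: code_separates => // /fi.
    by exists m.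
  (* A length beyond all the pairwise thresholds separates the f i at once. *)
  exists (\max_ij (m ij)).+1, [ffun i => code _ (f i)]; split.
    move=> i j; rewrite !ffunE => ij; apply: contrapT => nij.
    by apply: (mP (i, j)) ij => //; rewrite ltnS; exact: leq_bigmax.
  move=> i; have [p Xp pf] := fX i; exists p => //; rewrite pf ffunE; split=> //.
  by have [] := fP i.
apply: tracked_bigcup => n; apply: tracked_bigcup => t; apply: tracked_const => _.
apply: tracked_bigcap => i.
apply: (@tracked_exists _ _ [set y | B (laguerre_cell y.1 y.2) /\ code n (laguerre_cell y.1 y.2) = t i]).
by apply: trackedI; [exact: tracked_at_hausdorff_borel|exact: tracked_at_code].
Qed.

Lemma tracked_count (B : set (set 'rV[R]_l)) (A : set (\bar R)) : hausdorff_borel B ->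
  tracked_cfg [set X | A (@npoints R _ (laguerre X) B)].
Proof.
move=> bB.
have tN j : tracked_cfg [set X | @npoints R _ (laguerre X) B = count_value j].
  case: j => [|k].
    apply: (@eq_tracked _ _ _ _ [set X | forall k : nat, (k%:R%:E <= @npoints R _ (laguerre X) B)%E]).
      move=> mu X _; split => /= [h|-> k]; last exact: leey.
      have [[//|k] _ Nk] := @counting_value R _ (laguerre X `&` B).
      have := h k.+1; rewrite /npoints -Nk /= lee_fin ler_nat ltnn //.
    by apply: tracked_bigcap => k; exact: tracked_count_ge.
  apply: (@eq_tracked _ _ _ _ ([set X | (k%:R%:E <= @npoints R _ (laguerre X) B)%E] `&`
      ~` [set X | (k.+1%:R%:E <= @npoints R _ (laguerre X) B)%E])).
    move=> mu X _; split => /= [[h1 h2]|->]; last first.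
      by split => //=; rewrite lee_fin ler_nat ltnn.
    have [[|j] _ Nk] := @counting_value R _ (laguerre X `&` B).
      by move: h2; rewrite /npoints -Nk /= leey.
    move: h1 h2; rewrite /npoints -Nk /= !lee_fin !ler_nat => kj /negP.
    by rewrite -ltnNge ltnS => jk; have /eqP -> : j == k by rewrite eqn_leq jk.
  by apply: trackedI; [exact: tracked_count_ge|apply: trackedC; exact: tracked_count_ge].
apply: (@eq_tracked _ _ _ _ [set X | exists j, A (count_value j) /\ @npoints R _ (laguerre X) B = count_value j]).
  move=> mu X _; split => /= [[j [Aj ->]]//|AN].
  have [j _ Nj] := @counting_value R _ (laguerre X `&` B); exists j.
  by rewrite Nj.
by apply: tracked_bigcup => j; apply: tracked_const => _; exact: tN.
Qed.

(** The measurability of the Laguerre tessellation as a function of its points,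
    in the form that transfers to both processes. *)
Lemma tracked_particle_config (E : set (particle_config R l)) : measurable E ->
  tracked_cfg [set X | E (laguerre X)].
Proof.
apply: (@tracked_smallest _ _ _ _ _ (@laguerre R l)).
  by apply: eq_tracked (trackedC (tracked0 _)) => z X _; split => // _ [].
move=> _ [B [A [bB mA ->]]].
exact: (@tracked_count _ A bB).
Qed.

End cell_counts.

(** * Point sets as measures, and the section as a Laguerre tessellation *)
Section point_measure.
Context d (T : measurableType d) (R : realType) (X : set T).
Local Open Scope ereal_scope.

Definition point_measure (B : set T) : \bar R := counting (X `&` B).

Let point_measure0 : point_measure set0 = 0.
Proof. by rewrite /point_measure setI0 /counting asboolT// fset_set0. Qed.

Let point_measure_ge0 B : 0 <= point_measure B.
Proof. by rewrite /point_measure /counting; case: asboolP => _; rewrite ?lee_fin ?leey. Qed.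

Let point_measure_sigma_additive : semi_sigma_additive point_measure.
Proof.
move=> F mF tF mUF; rewrite /point_measure setI_bigcupr.
pose nu : {measure set (g_sigma_algebraType [set: set T]) -> \bar R} := counting.
apply: (@measure_semi_sigma_additive _ _ _ nu (fun n => X `&` F n)).
- by move=> n; exact: sub_sigma_algebra.
- exact: trivIset_setIl.
- exact: sub_sigma_algebra.
Qed.

HB.instance Definition _ := isMeasure.Build _ _ _ point_measure
  point_measure0 point_measure_ge0 point_measure_sigma_additive.

End point_measure.

Section counting_finite.
Context {R : realType} (S : choiceType) (Y : set S).
Local Open Scope ereal_scope.

Lemma counting_lty : finite_set Y -> (counting Y : \bar R) < +oo.
Proof. by move=> fY; rewrite /counting asboolT// ltry. Qed.

Lemma counting_eq0 : (counting Y : \bar R) = 0 <-> Y = set0.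
Proof.
split=> [|->]; last by rewrite /counting asboolT// fset_set0.
rewrite /counting; case: asboolP => // fY [] /eqP; rewrite (eqr_nat R _ 0) => /eqP.
by move/eqP; rewrite cardfs_eq0 => /eqP/fset_set_set0; exact.
Qed.

End counting_finite.

Section section_is_laguerre.
Context {R : realType} (l m : nat).

Lemma enorm_sqr_embed (x : 'rV[R]_(l + m)) (w : 'rV[R]_l) :
  enorm (x - embed (l + m) w) ^+ 2 = power w (radial_map x).
Proof.
rewrite /enorm sqr_sqrtr; last by apply: sumr_ge0 => i _; exact: sqr_ge0.
rewrite -/(sqnorm _) /power /radial_map /=.
have -> : embed (l + m) w = row_mx w 0.
  apply/rowP => j; rewrite !mxE; case: splitP => [i ji|k jk].
    have jl : (val j < l)%N by rewrite /= ji.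
    by rewrite insubT /=; congr (w _ _); exact/val_inj.
  by rewrite insubN /= ?mxE// jk -leqNgt leq_addr.
rewrite -{1}(hsubmxK x) opp_row_mx add_row_mx sqnorm_row_mx oppr0 addr0.
by congr (_ + _); apply: eq_bigr => i _; rewrite !mxE -sqrrN opprB.
Qed.

(** Points of Z with the same image as x impose no condition on either side: they
    are at the same distance from all points of R^l. *)
Lemma embed_preimage_voronoi_cell (Z : set 'rV[R]_(l + m)) x :
  @embed R l (l + m) @^-1` voronoi_cell Z x =
  laguerre_cell (@radial_map R l m @` Z) (radial_map x).
Proof.
have le_sqr (y z : 'rV[R]_(l + m)) : (enorm y <= enorm z) = (enorm y ^+ 2 <= enorm z ^+ 2).
  by rewrite ler_sqr// ?nnegrE sqrtr_ge0.
apply/seteqP; split => w /=.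
  move=> h; apply/laguerre_cellE => _ [y Zy <-].
  have [->//|yx] := pselect (y = x).
  by rewrite -!enorm_sqr_embed -le_sqr; apply: h; split.
move=> /laguerre_cellE h y [Zy _]; rewrite le_sqr !enorm_sqr_embed.
by apply: h; exists y.
Qed.

Lemma tess_section_voronoi (Z : set 'rV[R]_(l + m)) :
  tess_section l (voronoi Z) = laguerre (@radial_map R l m @` Z).
Proof.
rewrite /tess_section /laguerre; congr (_ `\ _); apply/seteqP; split => c.
  move=> [_ [x Zx <-] <-]; rewrite embed_preimage_voronoi_cell.
  by exists (radial_map x) => //; exists x.
move=> [_ [x Zx <-] <-]; exists (voronoi_cell Z x); first by exists x.
exact: embed_preimage_voronoi_cell.
Qed.

End section_is_laguerre.

Section point_fields.
Context {R : realType} (l m : nat).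
Local Notation point := ('rV[R]_l * R)%type.
Local Notation T := (g_sigma_algebraType (@open point)).
Local Notation M := (lfspace R (@box R l)).

Lemma lfmeasure_of_points_fin (X : set point) :
  (forall K, compact K -> finite_set (X `&` K)) ->
  forall n, (point_measure R (X : set T) (box n) < +oo)%E.
Proof. by move=> Xfin n; apply: counting_lty; apply: Xfin; exact: compact_box. Qed.

Definition lfmeasure_of_points (X : set point)
    (Xfin : forall K, compact K -> finite_set (X `&` K)) : M :=
  LFMeasure (lfmeasure_of_points_fin Xfin).

Lemma lfmeasure_of_points_represents (X : set point) Xfin :
  nonneg_heights X -> represents (@lfmeasure_of_points X Xfin) X.
Proof. by move=> X0; split => // A bA; exact: counting_eq0. Qed.

Local Notation S := (g_sigma_algebraType (@open 'rV[R]_(l + m))).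

Lemma measurable_radial_map : measurable_fun [set: S] (@radial_map R l m : S -> T).
Proof.
move=> _ A mA; rewrite setTI; apply: borel_preimage mA.
exact: radial_map_continuous.
Qed.

Lemma compact_radial_preimage n :
  compact (@radial_map R l m @^-1` (box n : set point)).
Proof.
apply: bounded_closed_compact; last first.
  apply: preimage_closed; last exact: closed_box.
  by move=> x _; exact: radial_map_continuous.
exists (n%:R + 1); split; first exact: num_real.
move=> N nN x /= [xl xr]; rewrite (le_trans _ (ltW nN))//.
rewrite [leLHS]mx_normrE; apply/bigmax_leP; split => [|[i j] _ /=].
  by rewrite addr_ge0.
rewrite ord1 -(splitK j); case: (fintype.split j) => k /=.
  apply: (@le_trans _ _ n%:R); last by rewrite lerDl.
  have := @le_bigmax _ _ _ 0 (fun ij => `|lsubmx x ij.1 ij.2|) (0, k).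
  rewrite /= mxE => /le_trans; apply.
  by rewrite -mx_normrE.
have xk : x 0 (rshift l k) ^+ 2 <= n%:R.
  rewrite (le_trans _ xr)// (le_trans _ (ler_norm _))//.
  rewrite /radial_map/= /sqnorm (bigD1 k)//= mxE lerDl.
  by apply: sumr_ge0 => i' _; exact: sqr_ge0.
rewrite -ler_sqr ?nnegrE// ?addr_ge0// real_normK ?num_real//.
by rewrite (le_trans xk)//; have : (0:R) <= n%:R by []; nra.
Qed.

Lemma lfmeasure_of_radial_fin (Z : set 'rV[R]_(l + m)) :
  (forall K, compact K -> finite_set (Z `&` K)) ->
  forall n, (image_measure (point_measure R (Z : set S)) measurable_radial_map (box n) < +oo)%E.
Proof.
move=> Zfin n; apply: counting_lty; apply: Zfin; exact: compact_radial_preimage.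
Qed.

(** The image of the counting measure of Z, which counts a point of the image of
    Z as often as it is attained. Keeping multiplicities makes the counts on B
    equal to counts of Z on the preimage of B, whose law is known. *)
Definition lfmeasure_of_radial (Z : set 'rV[R]_(l + m))
    (Zfin : forall K, compact K -> finite_set (Z `&` K)) : M :=
  LFMeasure (lfmeasure_of_radial_fin Zfin).

Lemma lfmeasure_of_radial_represents (Z : set 'rV[R]_(l + m)) Zfin :
  represents (@lfmeasure_of_radial Z Zfin) (@radial_map R l m @` Z).
Proof.
split; first by move=> _ [x _ <-]; exact: sqnorm_ge0.
move=> A bA; apply: iff_trans (counting_eq0 _) _.
split => h; apply/seteqP; split => //.
  by move=> _ [[x Zx <-] Ax]; have : (Z `&` @radial_map R l m @^-1` A) x by []; rewrite h.
move=> x [Zx Ax]; have : (@radial_map R l m @` Z `&` A) (radial_map x) by split => //; exists x.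
by rewrite h.
Qed.

End point_fields.

(** * Comparison of the two tessellations *)
Section poisson_counts.
Context {R : realType}.
Local Open Scope ereal_scope.

Lemma poisson_process_count_eq
    d1 (O1 : measurableType d1) (P1 : probability O1 R) (T1 : topologicalType)
    (L1 : set T1 -> \bar R) (X1 : O1 -> set T1)
    d2 (O2 : measurableType d2) (P2 : probability O2 R) (T2 : topologicalType)
    (L2 : set T2 -> \bar R) (X2 : O2 -> set T2)
    (B1 : set T1) (B2 : set T2) (k : nat) :
  poisson_process P1 L1 X1 -> poisson_process P2 L2 X2 ->
  borel B1 -> borel B2 -> L1 B1 = L2 B2 ->
  P1 [set w | (npoints (X1 w) B1 : \bar R) = k%:R%:E] =
  P2 [set w | (npoints (X2 w) B2 : \bar R) = k%:R%:E].
Proof.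
move=> [_ mN1 law1 _] [_ mN2 law2 _] bB1 bB2 L12.
have infinite_law d (O : measurableType d) (P : probability O R) (N : O -> \bar R) :
    measurable_fun [set: O] N -> P [set w | N w = +oo] = 1 ->
    P [set w | N w = k%:R%:E] = 0.
  move=> mN Poo.
  have mpre A : measurable A -> measurable (N @^-1` A).
    by move=> mA; rewrite -[X in measurable X]setTI; exact: mN.
  have moo : measurable [set w | N w = +oo] by apply: (mpre [set +oo]); exact: emeasurable_set1.
  apply/eqP; rewrite -measure_le0.
  have <- : P (~` [set w | N w = +oo]) = 0 by rewrite probability_setC// Poo subee.
  apply: le_measure; first by apply/mem_set; apply: (mpre [set k%:R%:E]); exact: emeasurable_set1.
    by apply/mem_set; exact: measurableC.
  by move=> w /= ->.
have := law1 B1 bB1; have := law2 B2 bB2; rewrite L12.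
case: (L2 B2) => [r h1 h2|h1 h2|h1 h2]; first by rewrite h1 h2.
- by rewrite (infinite_law _ _ P1)// ?(infinite_law _ _ P2)//; [exact: mN2|exact: mN1].
- by rewrite (infinite_law _ _ P1)// ?(infinite_law _ _ P2)//; [exact: mN2|exact: mN1].
Qed.

End poisson_counts.

(** The event that the tessellation lies in E is, for both processes, the event
    that its random measure lies in the same set H; the two random measures have
    the same law. *)
Lemma section_law (R : realType) (l m : nat) (rho : R) (m_gt0 : (0 < m)%N)
    (rho_gt0 : 0 < rho)
    d1 (O1 : measurableType d1) (P1 : probability O1 R)
    (zeta : O1 -> set 'rV[R]_(l + m)) (zetaP : homogeneous_poisson P1 rho zeta)
    d2 (O2 : measurableType d2) (P2 : probability O2 R)
    (eta : O2 -> set ('rV[R]_l * R)%type)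
    (etaP : beta_poisson P2 (((l + m)%:R - l%:R) / 2 - 1)
      (pi `^ ((l + m).+1%:R / 2) * rho / Gamma ((l + m).+1%:R / 2)) eta) :
  same_distribution P1 (fun w => tess_section l (voronoi (zeta w)))
                    P2 (fun w => laguerre (eta w)).
Proof.
have [eta0 etaPP] := etaP.
have [zfin mz lawz indz] := zetaP; have [efin me lawe inde] := etaPP.
pose mu1 w := lfmeasure_of_radial (zfin w).
pose mu2 w := lfmeasure_of_points (efin w).
have bpre (B : set ('rV[R]_l * R)) : borel B -> borel (@radial_map R l m @^-1` B).
  by apply: borel_preimage; exact: radial_map_continuous.
have mmu1 : measurable_fun [set: O1] mu1.
  by apply: measurable_to_lfspace => B mB; exact: (mz _ (bpre _ mB)).
have mmu2 : measurable_fun [set: O2] mu2.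
  by apply: measurable_to_lfspace => B mB; exact: (me _ mB).
have rep1 w : represents (mu1 w) (@radial_map R l m @` zeta w).
  exact: lfmeasure_of_radial_represents.
have rep2 w : represents (mu2 w) (eta w).
  by apply: lfmeasure_of_points_represents => p; exact: eta0.
have law12 : forall E, measurable E -> P1 (mu1 @^-1` E) = P2 (mu2 @^-1` E).
  apply: lf_law_unique => //.
  - by move=> w B _; exact: (@counting_value R _ (zeta w `&` @radial_map R l m @^-1` B)).
  - by move=> w B _; exact: (@counting_value R _ (eta w `&` B)).
  - move=> B k mB; apply: (poisson_process_count_eq k zetaP etaPP (bpre _ mB) mB).
    exact: intensity_radial_map.
  - move=> n C A mC tC mA; apply: (indz n (fun i => @radial_map R l m @^-1` C i) A) => //.
    + by move=> i; apply: bpre; exact: mC.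
    + by apply/trivIsetP => i j _ _ ij; rewrite -preimage_setI (trivIsetP.1 tC i j)// preimage_set0.
have tr (E : set (particle_config R l)) : measurable E -> exists2 H, measurable H &
    (fun w => tess_section l (voronoi (zeta w))) @^-1` E = mu1 @^-1` H /\
    (fun w => laguerre (eta w)) @^-1` E = mu2 @^-1` H.
  move=> mE; have [H mH HE] := tracked_particle_config mE; exists H => //.
  split; apply/seteqP; split => w /=; rewrite ?tess_section_voronoi.
  - by move=> h; apply/(HE _ _ (rep1 w)).
  - by move/(HE _ _ (rep1 w)).
  - by move=> h; apply/(HE _ _ (rep2 w)).
  - by move/(HE _ _ (rep2 w)).
split.
- move=> _ E mE; have [H mH [-> _]] := tr E mE; exact: mmu1.
- move=> _ E mE; have [H mH [_ ->]] := tr E mE; exact: mmu2.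
- move=> E mE; rewrite /pushforward; have [H mH [-> ->]] := tr E mE; exact: law12.
Qed.

Theorem corollary4p2 (R : realType) (d l : nat) (rho : R)
    (d_ge2 : (2 <= d)%N) (l_bounds : (1 <= l <= d - 1)%N) (rho_gt0 : 0 < rho)
    (d1 : measure_display) (O1 : measurableType d1) (P1 : probability O1 R)
    (zeta : O1 -> set 'rV[R]_d) (zetaP : homogeneous_poisson P1 rho zeta)
    (d2 : measure_display) (O2 : measurableType d2) (P2 : probability O2 R)
    (eta : O2 -> set ('rV[R]_l * R)%type)
    (etaP : beta_poisson P2
      ((d%:R - l%:R) / 2 - 1)
      (pi `^ (d.+1%:R / 2) * rho / Gamma (d.+1%:R / 2)) eta) :
  same_distribution P1 (fun w => tess_section l (voronoi (zeta w)))
                    P2 (fun w => laguerre (eta w)).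
Proof.
have [l_ge1 l_led] := andP l_bounds.
have l_ltd : (l < d)%N by rewrite (leq_ltn_trans l_led)// subn1 prednK// ltnW.
have [m m_gt0 dE] : exists2 m, (0 < m)%N & d = (l + m)%N.
  by exists (d - l)%N; rewrite ?subn_gt0// subnKC// ltnW.
subst d; exact: (@section_law R l m rho m_gt0 rho_gt0 d1 O1 P1 zeta zetaP d2 O2 P2 eta etaP).
Qed.
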